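(* Let $N\in\mathbb{N}$ and $p\in[1,\infty)$. (1) The mapping that assigns to a filtered process $\mathbb X\in\mathrm{FP}_p$ its Doob-decomposition $\mathbb{D}^{\mathbb X}$ is Lipschitz continuous with respect to $\mathcal{AW}_p$. (2) If $G_t:\mathbb{R}^t\to\mathbb{R}$ is bounded and continuous (resp. bounded and Lipschitz) for each $1\le t\le N$, then the optimal stopping value $$\mathbb X\mapsto\sup_{\tau}\mathbb{E}[G_\tau(X_1,\dots,X_\tau)],$$ where $\tau$ runs through all $(\mathcal{F}^{\mathbb X}_t)_{t=1}^N$-stopping times with values in $\{1,\dots,N\}$, is continuous (resp. Lipschitz) on $\mathrm{FP}_p$ with respect to $\mathcal{AW}_p$.
   Context: A filtered process is a tuple $\mathbb{X}=(\Omega^{\mathbb X},\mathcal{F}^{\mathbb X},\mathbb{P}^{\mathbb X},(\mathcal{F}^{\mathbb X}_t)_{t=1}^N,(X_t)_{t=1}^N)$ consisting of a probability space, a filtration on it, and a real-valued process $X=(X_t)_{t=1}^N$ adapted to the filtration. $\mathcal{FP}_p$ is the class of all filtered processes with $\mathbb{E}[\|X\|_p^p]=\mathbb{E}[\sum_{t=1}^N|X_t|^p]<\infty$. A coupling of $\mathbb X,\mathbb Y$ is a probability $\pi$ on $(\Omega^{\mathbb X}\times\Omega^{\mathbb Y},\mathcal{F}^{\mathbb X}\otimes\mathcal{F}^{\mathbb Y})$ with marginals $\mathbb{P}^{\mathbb X},\mathbb{P}^{\mathbb Y}$. Identify $\mathcal{F}^{\mathbb X}_t$ and $\mathcal{F}^{\mathbb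 Y}_t$ with the corresponding $\sigma$-algebras on the product space. $\pi$ is causal from $\mathbb X$ to $\mathbb Y$ if, for every $1\le t\le N$, under $\pi$ the $\sigma$-algebras $\mathcal{F}^{\mathbb X}_N$ and $\mathcal{F}^{\mathbb Y}_t$ are conditionally independent given $\mathcal{F}^{\mathbb X}_t$; it is anticausal if the same holds with the roles of $\mathbb X$ and $\mathbb Y$ exchanged; it is bicausal if it is both. $\mathrm{Cpl}_{\mathrm{bc}}(\mathbb X,\mathbb Y)$ denotes the set of bicausal couplings and $\mathcal{AW}_p^p(\mathbb X,\mathbb Y):=\inf_{\pi\in\mathrm{Cpl}_{\mathrm{bc}}(\mathbb X,\mathbb Y)}\mathbb{E}_\pi[\|X-Y\|_p^p]$. $\mathrm{FP}_p$ is the set of equivalence classes of $\mathcal{FP}_p$ obtained by identifying $\mathbb X,\mathbb Y$ whenever $\mathcal{AW}_p(\mathbb X,\mathbb Y)=0$; the objects in the claim do not depend on the choice of representatives. The Doob-decomposition of $\mathbb X$ is the $\mathbb{R}\times\mathbb{R}$-valued filtered process $\mathbb{D}^{\mathbb X}=(\Omega^{\mathbb X},\mathcal{F}^{\mathbb X},\mathbb{P}^{\mathbb X},(\mathcal{F}^{\mathbb X}_t)_{t=1}^N,(M_t,A_t)_{t=1}^N)$, where $X=M+A$ is the unique decomposition with $A_1=0$, $M$ a martingale and $A$ predictable ($A_t$ is $\mathcal{F}^{\mathbb X}_{t-1}$-measurable for $t\ge2$). For such $\mathbb{R}\times\mathbb{R}$-valued processes $\mathcal{AW}_p$ is defined in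 the same way, with cost $\sum_{t=1}^N(|M_t-M'_t|^p+|A_t-A'_t|^p)$. *)

(* Defs.v *)
From HB Require Import structures.
From mathcomp Require Import all_boot all_order all_algebra.
From mathcomp Require Import all_classical all_reals all_analysis.

Set Implicit Arguments.
Unset Strict Implicit.
Unset Printing Implicit Defensive.

Import Order.TTheory GRing.Theory Num.Theory.
Import numFieldNormedType.Exports.

Local Open Scope classical_set_scope.
Local Open Scope ring_scope.

(* Time runs over the natural numbers t with 1 <= t <= N; the values of a
   filtration or a process at other indices are unconstrained and never used. *)

Section measurability_conditioning.
Context d (T : measurableType d) (R : realType).

(* [G] is always a sigma-algebra below, so that the one generated by [G],
   which is what [g_sigma_algebraType] carries, is [G] itself. *)
Definition measurable_wrt (G : set_system T) d' (E : measurableType d')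
    (f : T -> E) : Prop :=
  measurable_fun [set: g_sigma_algebraType G] (f : g_sigma_algebraType G -> E).

Definition is_cond_exp (P : probability T R) (G : set_system T)
    (X Z : T -> R) : Prop :=
  [/\ measurable_wrt G Z,
      P.-integrable setT (EFin \o Z) &
      forall C, G C ->
        (\int[P]_(w in C) (Z w)%:E = \int[P]_(w in C) (X w)%:E)%E].

(* P(a `&` b | G) = P(a | G) P(b | G) almost surely. Versions of a conditional
   probability exist and agree almost surely, so one may choose them. *)
Definition cond_independent (P : probability T R) (A B G : set_system T) : Prop :=
  forall a b, A a -> B b -> exists f g : T -> R,
    [/\ is_cond_exp P G (\1_a) f,
        is_cond_exp P G (\1_b) g &
        is_cond_exp P G (\1_(a `&` b)) (f \* g)].

End measurability_conditioning.

Record filteredSpace (R : realType) (N : nat) := FilteredSpace {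
  fs_display : measure_display;
  fs_space :> measurableType fs_display;
  fs_prob : probability fs_space R;
  fs_filt : nat -> set_system fs_space;
  fs_filt_sigma_algebra : forall t, (1 <= t <= N)%N ->
    sigma_algebra setT (fs_filt t);
  fs_filt_measurable : forall t, (1 <= t <= N)%N ->
    fs_filt t `<=` measurable;
  fs_filt_nondecreasing : forall s t, (1 <= s)%N -> (s <= t <= N)%N ->
    fs_filt s `<=` fs_filt t
}.
Arguments fs_prob {R N} f.
Arguments fs_filt {R N} f t.

Record filteredProcess (R : realType) (N : nat) d (E : measurableType d) :=
  FilteredProcess {
  fp_space :> filteredSpace R N;
  fp_val : nat -> fp_space -> E;
  fp_adapted : forall t, (1 <= t <= N)%N ->
    measurable_wrt (fs_filt fp_space t) (fp_val t)
}.
Arguments filteredProcess : clear implicits.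
Arguments filteredProcess R N {d} E.
Arguments fp_val {R N d E} f t w.
Arguments FilteredProcess {R N d E} fp_space fp_val fp_adapted.

Section adapted_wasserstein.
Context (R : realType) (N : nat).

Section couplings.
Context (X Y : filteredSpace R N).

Definition is_coupling (pi : probability (X * Y)%type R) : Prop :=
  (forall A, measurable A -> pushforward pi fst A = fs_prob X A) /\
  (forall B, measurable B -> pushforward pi snd B = fs_prob Y B).

Definition liftl (G : set_system X) : set_system (X * Y)%type :=
  preimage_set_system setT fst G.

Definition liftr (G : set_system Y) : set_system (X * Y)%type :=
  preimage_set_system setT snd G.

Definition causal (pi : probability (X * Y)%type R) : Prop :=
  forall t, (1 <= t <= N)%N ->
    cond_independent pi (liftl (fs_filt X N)) (liftr (fs_filt Y t))
                        (liftl (fs_filt X t)).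

Definition anticausal (pi : probability (X * Y)%type R) : Prop :=
  forall t, (1 <= t <= N)%N ->
    cond_independent pi (liftr (fs_filt Y N)) (liftl (fs_filt X t))
                        (liftr (fs_filt Y t)).

Definition bicausal_couplings : set (probability (X * Y)%type R) :=
  [set pi | [/\ is_coupling pi, causal pi & anticausal pi]].

End couplings.
Arguments bicausal_couplings : clear implicits.

Definition AW_cost d (E : measurableType d) (c : E -> E -> R) (p : R)
    (X Y : filteredProcess R N E) : \bar R :=
  ((ereal_inf [set 'E_pi[(fun w =>
      \sum_(1 <= t < N.+1) c (fp_val X t w.1) (fp_val Y t w.2))%R]
    | pi in bicausal_couplings X Y]) `^ p^-1)%E.

Definition AW (p : R) (X Y : filteredProcess R N R) : \bar R :=
  AW_cost (fun x y : R => `|x - y| `^ p) p X Y.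

Definition AW2 (p : R) (X Y : filteredProcess R N (R * R)%type) : \bar R :=
  AW_cost (fun x y : R * R => `|x.1 - y.1| `^ p + `|x.2 - y.2| `^ p) p X Y.

Definition FP (p : R) (X : filteredProcess R N R) : Prop :=
  ('E_(fs_prob X)[(fun w =>
     \sum_(1 <= t < N.+1) `|fp_val X t w| `^ p)%R] < +oo)%E.

(* FP_p is the quotient of [FP p] by AW_p = 0; (Lipschitz) continuity on it is
   (Lipschitz) continuity for the pseudometric on representatives, which entails
   compatibility with the quotient. *)
Definition AW_continuous (p : R)
    (v : filteredProcess R N R -> \bar R) : Prop :=
  forall X, FP p X -> forall e : R, 0 < e -> exists2 del : R, 0 < del &
    forall Y, FP p Y -> (AW p X Y < del%:E)%E -> (`|v X - v Y| < e%:E)%E.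

Definition AW_lipschitz (p : R)
    (v : filteredProcess R N R -> \bar R) : Prop :=
  exists2 L : R, 0 <= L &
    forall X Y, FP p X -> FP p Y -> (`|v X - v Y| <= L%:E * AW p X Y)%E.

End adapted_wasserstein.

Section doob.
Context (R : realType) (N : nat).

Definition martingale (S : filteredSpace R N) (M : nat -> S -> R) : Prop :=
  [/\ forall t, (1 <= t <= N)%N ->
        measurable_wrt (E := R) (fs_filt S t) (M t),
      forall t, (1 <= t <= N)%N ->
        (fs_prob S).-integrable setT (EFin \o M t) &
      forall t, (1 <= t < N)%N ->
        is_cond_exp (fs_prob S) (fs_filt S t) (M t.+1) (M t)].

Definition predictable (S : filteredSpace R N) (A : nat -> S -> R) : Prop :=
  forall t, (1 <= t < N)%N ->
    measurable_wrt (E := R) (fs_filt S t) (A t.+1).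

Definition doob_decomposition (X : filteredProcess R N R)
    (M A : nat -> X -> R) : Prop :=
  [/\ forall t, (1 <= t <= N)%N -> forall w, fp_val X t w = M t w + A t w,
      forall w, A 1%N w = 0,
      martingale M &
      predictable A].

Lemma doob_adapted (X : filteredProcess R N R)
    (M A : nat -> X -> R) (h : doob_decomposition M A) t : (1 <= t <= N)%N ->
  measurable_wrt (E := (R * R)%type)
    (fs_filt X t) (fun w => (M t w, A t w)).
Proof.
move=> tN; have [_ A1 [Mad _ _] Apr] := h.
apply: (@measurable_fun_pair _ _ _ (g_sigma_algebraType (fs_filt X t))
  R R); first exact: Mad.
case: t tN => [//|[|t]] tN.
  rewrite (_ : A 1%N = cst 0); last exact/funext.
  exact: measurable_cst.
move=> mT B mB; rewrite measurable_g_measurableTypeE; last first.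
  exact: fs_filt_sigma_algebra.
have tN' : (1 <= t.+1 < N)%N by [].
have sub : fs_filt X t.+1 `<=` fs_filt X t.+2.
  by apply: fs_filt_nondecreasing => //; rewrite leqnSn.
apply: sub; have := Apr _ tN' measurableT B mB.
rewrite measurable_g_measurableTypeE //.
by apply: fs_filt_sigma_algebra; rewrite /= ltnW.
Qed.

Definition doob_process (X : filteredProcess R N R)
    (M A : nat -> X -> R) (h : doob_decomposition M A)
    : filteredProcess R N (R * R)%type :=
  FilteredProcess X (fun t w => (M t w, A t w)) (doob_adapted h).

End doob.

Section stopping.
Context (R : realType) (N : nat).

Definition stopping_time (S : filteredSpace R N) : set (S -> nat) :=
  [set tau | (forall w, (1 <= tau w <= N)%N) /\
     forall t, (1 <= t <= N)%N -> fs_filt S t [set w | (tau w <= t)%N]].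
Arguments stopping_time : clear implicits.

(* The column with (0-based) index i of the row vector is the value at time
   i + 1, so that the row is (X_1, ..., X_t). *)
Definition path_upto (X : filteredProcess R N R) (t : nat)
    (w : X) : 'rV[R]_t :=
  \row_(i < t) (fp_val X i.+1 w).
Arguments path_upto : clear implicits.

Definition stopping_value (G : forall t, 'rV[R]_t -> R)
    (X : filteredProcess R N R) : \bar R :=
  ereal_sup [set 'E_(fs_prob X)[fun w => G (tau w) (path_upto X (tau w) w)]%E
            | tau in stopping_time X].

End stopping.

(* Main.v *)
From HB Require Import structures.
Require Import Defs.
From mathcomp Require Import all_boot all_order all_algebra finmap.
From mathcomp Require Import all_classical all_reals all_analysis.
From mathcomp Require Import measurable_realfun ring lra.
Import Order.TTheory GRing.Theory Num.Theory.
Import numFieldNormedType.Exports.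
Local Open Scope classical_set_scope.
Local Open Scope ring_scope.

(** The key fact is that under a coupling which is causal from Y to X, an event of
    F_t^X has the same conditional probability given F_N^Y as given F_t^Y. Hence
    E[V | F_t^Y], for V an F_N^Y-measurable variable, is also the conditional
    expectation of V under the coupling given the join of F_t^X and F_t^Y.

    Doob decomposition: for a bicausal coupling,
    (M_t + A_(t+1)) - (M'_t + A'_(t+1)) is therefore the conditional expectation of
    X_(t+1) - Y_(t+1) given that join, so its L^p norm is controlled by the one of
    X_(t+1) - Y_(t+1), and the distance between the compensators is bounded by
    induction on t.

    Optimal stopping: a stopping time of X, transported by the coupling, is a
    randomized stopping time for Y; by backward induction (the Snell envelope
    argument) it does no better than the best stopping time of Y. So the two
    values differ by at most the expectation, under the coupling, of any bound for
    |G_t(X_1..X_t) - G_t(Y_1..Y_t)| that is uniform in t. *)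

Set Implicit Arguments.
Unset Strict Implicit.
Unset Printing Implicit Defensive.

(** * Conditional expectations *)

(** Conditional Jensen is obtained by duality: u is tested against |u|^(p-1) sgn u, truncated so
    that the integral of |u|^p is finite and half of it can be absorbed. This costs the factor 2^p
    seen in all constants. Likewise a <= del + del^(1-p) a^p does the work of Hölder's inequality,
    at the price of a factor 2. The join of two sigma-algebras is never formed: its random variables
    are the functions of a map into the product of two coarsened spaces, and orthogonality is tested
    on such functions. The lemmas on causality take two arbitrary maps [f] and [g] in place of the
    projections, so that exchanging [fst] and [snd] passes from causal to anticausal. For continuity
    of the stopping value, the radius has to be chosen from X before Y is known. Hence the bad paths
    are cut out as an event of the space of X, and the modulus of continuity off that event compares
    a path of X with an arbitrary row. *)

Local Notation intg P f := ((P).-integrable setT (EFin \o f)).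

Section real_integrals.
Context d (T : measurableType d) (R : realType) (P : probability T R).
Implicit Types (f g h W : T -> R) (C D : set T).

Lemma intg_measurable f : intg P f -> measurable_fun setT f.
Proof. by move=> /measurable_int /measurable_EFinP. Qed.

Lemma intgD f g : intg P f -> intg P g -> intg P (fun x => f x + g x).
Proof. by move=> If Ig; apply: (integrableD measurableT If Ig). Qed.

Lemma intgB f g : intg P f -> intg P g -> intg P (fun x => f x - g x).
Proof. by move=> If Ig; apply: (integrableB measurableT If Ig). Qed.

Lemma intgZ f r : intg P f -> intg P (fun x => r * f x).
Proof. by move=> If; apply: (integrableZl measurableT r If). Qed.

Lemma intg_le f g : measurable_fun setT f -> (forall x, `|f x| <= g x) ->
  intg P g -> intg P f.
Proof.
move=> mf fg; apply: le_integrable => //; first exact/measurable_EFinP.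
by move=> x _ /=; rewrite lee_fin (le_trans (fg x))// ler_norm.
Qed.

Lemma intgM_bounded h f (M : R) : measurable_fun setT h ->
  (forall x, `|h x| <= M) -> intg P f -> intg P (fun x => h x * f x).
Proof.
move=> mh hM If; have mf := intg_measurable If.
apply: (@intg_le _ (fun x => M * `|f x|)).
- exact: measurable_funM.
- by move=> x; rewrite normrM ler_wpM2r.
- by apply: intgZ; exact: integrable_norm.
Qed.

Lemma intg_bounded h (M : R) : measurable_fun setT h ->
  (forall x, `|h x| <= M) -> intg P h.
Proof.
move=> mh hM; apply: (@intg_le _ (cst M)) => //.
exact: finite_measure_integrable_cst.
Qed.

Lemma norm_indic_le1 D x : `|\1_D x : R| <= 1.
Proof. by rewrite indicE; case: (_ \in _); rewrite ?normr1 ?normr0. Qed.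

Lemma intg_indicM D f : measurable D -> intg P f ->
  intg P (fun x => \1_D x * f x).
Proof.
by move=> mD; apply: intgM_bounded (norm_indic_le1 D); exact: measurable_indic.
Qed.

Lemma integral_in_indic D f : measurable D -> intg P f ->
  (\int[P]_(x in D) (f x)%:E)%E = (\int[P]_x (\1_D x * f x))%:E.
Proof.
move=> mD If; rewrite integral_mkcond.
rewrite (_ : (EFin \o f) \_ D = EFin \o (fun x => \1_D x * f x)); last first.
  apply/funext => x; rewrite /= /patch indicE.
  by case: (_ \in _); rewrite ?mul1r ?mul0r.
by rewrite /Rintegral fineK//; apply: integrable_fin_num => //; exact: intg_indicM.
Qed.

Lemma Rintegral_big (I : Type) (s : seq I) (F : I -> T -> R) :
  (forall i, intg P (F i)) ->
  intg P (fun x => \sum_(i <- s) F i x) /\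
  \int[P]_x (\sum_(i <- s) F i x) = \sum_(i <- s) \int[P]_x F i x.
Proof.
move=> IF; elim: s => [|i s [IH1 IH2]].
  under eq_fun do rewrite big_nil.
  split; first exact: finite_measure_integrable_cst.
  by rewrite big_nil Rintegral_cst// mul0r.
split.
  under eq_fun do rewrite big_cons.
  exact: intgD.
under eq_Rintegral do rewrite big_cons.
by rewrite RintegralD// big_cons IH2.
Qed.

End real_integrals.

Import HBSimple HBNNSimple.

(** * Orthogonality to all functions of a map *)

Section orthogonality.
Context d d' (T : measurableType d) (T' : measurableType d') (R : realType).
Context (P : probability T R) (phi : T -> T') (mphi : measurable_fun setT phi).
Context (W : T -> R) (IW : intg P W).
Hypothesis W0 : forall D, measurable D ->
  \int[P]_x (\1_D (phi x) * W x) = 0.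

Let orth_sfun (h : {sfun T' >-> R}) :
  intg P (fun x => h (phi x) * W x) /\ \int[P]_x (h (phi x) * W x) = 0.
Proof.
have E x : h (phi x) * W x = \sum_(y <- (fset_set (range h) : seq R))
    (y * (\1_(h @^-1` [set y]) (phi x) * W x)).
  rewrite {1}fimfunE fsbig_finite//= mulr_suml.
  by apply: eq_bigr => y _; rewrite mulrA.
have I1 y : intg P (fun x => \1_(h @^-1` [set y]) (phi x) * W x).
  apply: (intgM_bounded (M := 1)) => //.
    by apply: measurableT_comp => //; exact: measurable_indic.
  by move=> x; exact: norm_indic_le1.
have I2 y := intgZ y (I1 y).
have [I S] := Rintegral_big (fset_set (range h)) I2.
under eq_fun do rewrite E.
split => //; rewrite S big1// => y _; rewrite RintegralZl// W0 ?mulr0//.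
Qed.

Let orth_nneg (h : T' -> R) : measurable_fun setT h -> (forall y, 0 <= h y) ->
  intg P (fun x => h (phi x) * W x) -> \int[P]_x (h (phi x) * W x) = 0.
Proof.
move=> mh h0 Ih.
have mhE : measurable_fun setT (EFin \o h) by exact/measurable_EFinP.
pose g n := nnsfun_approx measurableT mhE n.
(* The simple approximations stay below [h], so the integrable |h(phi x) W x| dominates all the
   products. *)
have [||||| _ _] := @dominated_convergence _ _ _ P _ measurableT
  (fun n x => (g n (phi x) * W x)%:E) (fun x => (h (phi x) * W x)%:E)
  (fun x => `|(h (phi x) * W x)|%:E).
- by move=> n; apply: measurable_int (orth_sfun (g n)).1.
- exact: measurable_int Ih.
- apply: aeW => x _; rewrite (_ : (fun n => _) = (fun n => (g n (phi x))%:E * (W x)%:E)%E)//.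
  rewrite EFinM; apply: cvgeZr => //.
  apply: cvg_nnsfun_approx => // y _.
  by rewrite lee_fin.
- exact: integrable_norm Ih.
- apply: aeW => x n _; rewrite /= lee_fin !normrM ler_wpM2r// ger0_norm//.
  rewrite ger0_norm// -lee_fin /g nnsfun_approxE; apply: le_approx => // y _.
  by rewrite lee_fin.
rewrite (_ : (fun n => _) = cst 0%E); last first.
  apply/funext => n; have [Ign g0] := orth_sfun (g n).
  rewrite -[LHS]fineK; last exact: (integrable_fin_num measurableT Ign).
  by congr EFin; exact: g0.
by rewrite /Rintegral => /cvg_lim <-//; rewrite lim_cst.
Qed.

(** Extension from indicators to simple functions, then to nonnegative ones, then to differences.
    Conditional expectations are defined by events only; this supplies the other test functions. *)
Lemma Rintegral_orthogonal (h : T' -> R) : measurable_fun setT h ->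
  intg P (fun x => h (phi x) * W x) -> \int[P]_x (h (phi x) * W x) = 0.
Proof.
move=> mh Ih.
have mW := intg_measurable IW.
have Hle (k : T' -> R) : measurable_fun setT k ->
    (forall y, `|k y| <= `|h y|) -> intg P (fun x => k (phi x) * W x).
  move=> mk kh; apply: (@intg_le _ _ _ _ _ (fun x => `|h (phi x) * W x|)).
  - by apply: measurable_funM => //; exact: measurableT_comp.
  - by move=> x; rewrite !normrM ler_wpM2r.
  - exact: integrable_norm Ih.
have mp : measurable_fun setT h^\+ by exact: measurable_funrpos.
have mn : measurable_fun setT h^\- by exact: measurable_funrneg.
have Ip : intg P (fun x => h^\+ (phi x) * W x).
  apply: Hle => // y; rewrite /funrpos ger0_norm; last by rewrite le_max lexx orbT.
  by rewrite ge_max normr_ge0 ler_norm.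
have In : intg P (fun x => h^\- (phi x) * W x).
  apply: Hle => // y; rewrite /funrneg ger0_norm; last by rewrite le_max lexx orbT.
  by rewrite ge_max normr_ge0 -normrN ler_norm.
have E x : h (phi x) * W x = h^\+ (phi x) * W x - h^\- (phi x) * W x.
  by rewrite -mulrBl -[in LHS](funrposBneg h).
under eq_Rintegral do rewrite E.
by rewrite RintegralB// !orth_nneg ?subrr// => y;
  rewrite ?funrneg_ge0 ?funrpos_ge0.
Qed.

End orthogonality.

Lemma measurable_set_bool d (T : measurableType d) (b : T -> bool) :
  measurable_fun setT b -> measurable [set x | b x].
Proof.
move=> mb; rewrite (_ : [set x | b x] = setT `&` b @^-1` [set true]).
  exact: mb.
by rewrite setTI; apply/seteqP; split => x /=.
Qed.

Lemma measurable_set_le d (T : measurableType d) (R : realType) (f g : T -> R) :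
  measurable_fun setT f -> measurable_fun setT g ->
  measurable [set x | f x <= g x].
Proof. by move=> mf mg; exact/measurable_set_bool/measurable_fun_ler. Qed.

Lemma measurable_set_lt d (T : measurableType d) (R : realType) (f g : T -> R) :
  measurable_fun setT f -> measurable_fun setT g ->
  measurable [set x | f x < g x].
Proof. by move=> mf mg; exact/measurable_set_bool/measurable_fun_ltr. Qed.

Lemma measurable_norm_powR d (T : measurableType d) (R : realType) (p : R)
    (f : T -> R) :
  measurable_fun setT f -> measurable_fun setT (fun x => `|f x| `^ p).
Proof.
move=> mf; apply: (measurableT_comp (measurable_powR p)).
exact: measurableT_comp.
Qed.

(** * An L^p contraction for conditional expectations *)

Section contraction.
Context d d' (T : measurableType d) (T' : measurableType d') (R : realType).
Context (P : probability T R) (phi : T -> T') (mphi : measurable_fun setT phi).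
Context (p : R) (p_ge1 : 1 <= p).

Let p0 : 0 < p. Proof. exact: lt_le_trans p_ge1. Qed.

Let p1 : 0 <= p - 1. Proof. by rewrite subr_ge0. Qed.

(** A form of Young's inequality whose coefficient 1/2 allows a^p to be absorbed later. Either b <=
    a/2 and the first term suffices, or a < 2b and the second does. *)
Lemma powR_mul_le (a b : R) : 0 <= a -> 0 <= b ->
  a `^ (p - 1) * b <= 2^-1 * a `^ p + 2 `^ (p - 1) * b `^ p.
Proof.
move=> a0 b0; have [ba|ab] := leP b (2^-1 * a).
  apply: (@le_trans _ _ (2^-1 * a `^ p)); last by rewrite lerDl mulr_ge0 ?powR_ge0.
  rewrite -(mulr_powRB1 a0 p0) [leLHS]mulrC mulrA.
  by rewrite ler_wpM2r ?powR_ge0.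
apply: (@le_trans _ _ (2 `^ (p - 1) * b `^ p)); last first.
  by rewrite lerDr mulr_ge0 ?powR_ge0//; lra.
rewrite -(mulr_powRB1 b0 p0) mulrCA mulrC -powRM ?ler0n//.
by rewrite ler_wpM2l// ge0_ler_powR ?nnegrE ?p1//; lra.
Qed.

Context (u : T' -> R) (V : T -> R) (mu : measurable_fun setT u).
Context (IV : intg P V) (Iu : intg P (u \o phi)).
Hypothesis orth : forall D, measurable D ->
  \int[P]_x (\1_D (phi x) * (V x - u (phi x))) = 0.

Let B (n : nat) : set T' := [set y | `|u y| <= n%:R].

Let mB n : measurable (B n).
Proof. by apply: measurable_set_le => //; exact: measurableT_comp. Qed.

(** The duality test function |u|^(p-1) sgn u, cut off to [B n]: its product with u is |u|^p there,
    and the cutoff makes it bounded, hence a legitimate multiplier of integrable variables. *)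
Let h n y : R := `|u y| `^ (p - 1) * (\1_[set y | 0 <= u y] y - \1_[set y | u y < 0] y)
  * \1_(B n) y.

Let mh n : measurable_fun setT (h n).
Proof.
apply: measurable_funM; last exact: measurable_indic.
apply: measurable_funM; first exact: measurable_norm_powR.
apply: measurable_funB; apply: measurable_indic.
  exact: measurable_set_le.
exact: measurable_set_lt.
Qed.

Let hu n y : h n y * u y = \1_(B n) y * `|u y| `^ p.
Proof.
rewrite /h -[in RHS](@mulr_powRB1 _ `|u y|)//.
rewrite !indicE; case: (leP 0 (u y)) => u0.
  rewrite mem_set// memNset/=; last by rewrite ltNge u0.
  by rewrite ger0_norm//; ring.
rewrite memNset/=; last by rewrite leNgt u0.
by rewrite mem_set//= ltr0_norm//; ring.
Qed.

Let norm_h n y : `|h n y| = \1_(B n) y * `|u y| `^ (p - 1).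
Proof.
rewrite /h !normrM (ger0_norm (powR_ge0 _ _)) [X in _ * X]ger0_norm//.
rewrite [X in _ * X * _](_ : _ = 1) ?mulr1 1?mulrC//.
rewrite !indicE; case: (leP 0 (u y)) => u0.
  rewrite mem_set// memNset/=; last by rewrite ltNge u0.
  by rewrite subr0 normr1.
rewrite memNset/=; last by rewrite leNgt u0.
by rewrite mem_set//= sub0r normrN normr1.
Qed.

Let h_bounded n y : `|h n y| <= n%:R `^ (p - 1).
Proof.
rewrite norm_h indicE; have [|_] := boolP (y \in B n); last first.
  by rewrite mul0r powR_ge0.
by rewrite inE mul1r => yB; rewrite ge0_ler_powR ?nnegrE ?p1//; lra.
Qed.

Lemma Rintegral_truncated_contraction n : intg P (fun x => `|V x| `^ p) ->
  (\int[P]_x (\1_(B n) (phi x) * `|u (phi x)| `^ p)%:E <=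
   (2 `^ p)%:E * \int[P]_x (`|V x| `^ p)%:E)%E.
Proof.
move=> IVp.
have Ihu : intg P (fun x => h n (phi x) * u (phi x)).
  by apply: intgM_bounded (fun x => h_bounded n (phi x)) Iu; exact: measurableT_comp.
have IhV : intg P (fun x => h n (phi x) * V x).
  by apply: intgM_bounded (fun x => h_bounded n (phi x)) IV; exact: measurableT_comp.
have Itr : intg P (fun x => \1_(B n) (phi x) * `|u (phi x)| `^ p).
  by under eq_fun do rewrite -hu.
have E1 : \int[P]_x (h n (phi x) * V x) = \int[P]_x (h n (phi x) * u (phi x)).
  apply/eqP; rewrite -subr_eq0 -RintegralB//.
  under eq_Rintegral do rewrite -mulrBr.
  apply/eqP/(Rintegral_orthogonal mphi (intgB IV Iu) orth (mh n)).
  by under eq_fun do rewrite mulrBr; exact: intgB.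
set a := \int[P]_x (\1_(B n) (phi x) * `|u (phi x)| `^ p).
set b := \int[P]_x (`|V x| `^ p).
(* By [E1], u may be replaced by V against [h n], and [powR_mul_le] bounds the outcome pointwise.
   The truncation makes [a] finite, so that its half on the right can be subtracted. *)
have le_ab : a <= 2^-1 * a + 2 `^ (p - 1) * b.
  rewrite {1}/a; under eq_Rintegral do rewrite -hu.
  rewrite -E1 -!RintegralZl// -RintegralD//; [|exact: intgZ..].
  apply: le_Rintegral => //; first by apply: intgD; exact: intgZ.
  move=> x _; apply: le_trans (ler_norm _) _; rewrite normrM norm_h indicE.
  case: (phi x \in B n); rewrite ?mul1r ?mul0r ?mulr0 ?add0r.
    exact: powR_mul_le.
  by rewrite mulr_ge0 ?powR_ge0.
have le2 : a <= 2 `^ p * b.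
  by rewrite -(@mulr_powRB1 _ 2 p)//; lra.
have -> : (\int[P]_x (\1_(B n) (phi x) * `|u (phi x)| `^ p)%:E)%E = a%:E.
  by rewrite /a /Rintegral fineK//; exact: integrable_fin_num Itr.
have -> : (\int[P]_x (`|V x| `^ p)%:E)%E = b%:E.
  by rewrite /b /Rintegral fineK//; exact: integrable_fin_num IVp.
by rewrite -EFinM lee_fin.
Qed.

(** Conditional Jensen up to the factor 2^p: [orth] says that u o phi is the conditional expectation
    of V given phi. The truncated bounds pass to the limit by monotone convergence; if |V|^p is not
    integrable, the right side is infinite. *)
Lemma integral_contraction :
  (\int[P]_x (`|u (phi x)| `^ p)%:E <=
   (2 `^ p)%:E * \int[P]_x (`|V x| `^ p)%:E)%E.
Proof.
have mV := intg_measurable IV.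
have mVp : measurable_fun setT (fun x => `|V x| `^ p) by exact: measurable_norm_powR.
have [Voo|Vfin] := eqVneq (\int[P]_x (`|V x| `^ p)%:E)%E +oo%E.
  by rewrite Voo mulry gtr0_sg ?powR_gt0// mul1e leey.
have IVp : intg P (fun x => `|V x| `^ p).
  apply/integrableP; split; first exact/measurable_EFinP.
  under eq_integral do rewrite /= ger0_norm ?powR_ge0//.
  by rewrite ltey.
pose f n x := (\1_(B n) (phi x) * `|u (phi x)| `^ p)%:E.
have mup : measurable_fun setT (fun x => `|u (phi x)| `^ p).
  by apply: measurable_norm_powR; exact: measurableT_comp.
have mf n : measurable_fun setT (f n).
  apply/measurable_EFinP; apply: measurable_funM => //.
  by apply: measurableT_comp => //; exact: measurable_indic.
have f0 n x : setT x -> (0 <= f n x)%E by rewrite lee_fin mulr_ge0 ?powR_ge0.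
have ndf x : setT x -> {homo f ^~ x : n m / (n <= m)%N >-> (n <= m)%E}.
  move=> _ n m nm; rewrite /f lee_fin ler_wpM2r ?powR_ge0// !indicE.
  have [|_] := boolP (phi x \in B n); last by case: (_ \in _).
  rewrite inE /B /= => un; rewrite mem_set//=.
  by rewrite (le_trans un)// ler_nat.
have flim x : limn (f ^~ x) = (`|u (phi x)| `^ p)%:E.
  apply/cvg_lim => //; apply: cvg_near_cst.
  exists (Num.truncn `|u (phi x)|).+1 => // n /= un.
  rewrite /f indicE mem_set ?mul1r//= /B /=.
  by rewrite ltW// (lt_le_trans (truncnS_gt _))// ler_nat.
have := @cvg_monotone_convergence _ _ _ P _ measurableT f mf f0 ndf.
move=> /cvg_lim; under eq_integral do rewrite flim.
move=> <-//; apply: lime_le.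
  apply: ereal_nondecreasing_is_cvgn => n m nm; apply: ge0_le_integral => //.
  - by move=> x _; exact: f0.
  - by move=> x _; exact: (ndf x I n m nm).
by apply: nearW => n; exact: Rintegral_truncated_contraction.
Qed.

End contraction.

(** * Existence and calculus of conditional expectations *)

Section conditional_expectation.
Context d (T : measurableType d) (R : realType) (P : probability T R).
Context (G : set_system T) (sG : sigma_algebra setT G) (GT : G `<=` measurable).

Notation gT := (g_sigma_algebraType G).

Lemma measurable_gE : @measurable _ gT = G.
Proof. exact: measurable_g_measurableTypeE. Qed.

Lemma measurable_to_g : measurable_fun setT (idfun : T -> gT).
Proof.
by move=> _ B; rewrite measurable_gE setTI preimage_id; exact: GT.
Qed.

Lemma measurable_wrt_fun (f : T -> R) : measurable_wrt G f -> measurable_fun setT f.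
Proof. by move=> mf; exact: (measurableT_comp mf measurable_to_g). Qed.

Lemma measurable_wrt_set_lt (f g : T -> R) :
  measurable_wrt G f -> measurable_wrt G g -> G [set w | f w < g w].
Proof.
by move=> mf mg; have := @measurable_set_lt _ gT _ _ _ mf mg; rewrite measurable_gE.
Qed.

Lemma measurable_wrt_set_le (f g : T -> R) :
  measurable_wrt G f -> measurable_wrt G g -> G [set w | f w <= g w].
Proof.
by move=> mf mg; have := @measurable_set_le _ gT _ _ _ mf mg; rewrite measurable_gE.
Qed.

Lemma is_cond_expP (X Z : T -> R) : intg P X -> is_cond_exp P G X Z <->
  [/\ measurable_wrt G Z, intg P Z &
      forall C, G C -> \int[P]_w (\1_C w * Z w) = \int[P]_w (\1_C w * X w)].
Proof.
move=> IX; split=> -[mZ IZ ZX]; split => // C GC; have mC := GT GC.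
  by have := ZX _ GC; rewrite !integral_in_indic// => -[].
by rewrite !integral_in_indic// ZX.
Qed.

(** An instance of [Rintegral_orthogonal] for the identity map from T to T equipped with G, whose
    measurable functions are the G-measurable ones. Both products are assumed integrable because [h]
    may be unbounded. *)
Lemma cond_exp_pullout (X Z h : T -> R) : intg P X -> is_cond_exp P G X Z ->
  measurable_wrt G h -> intg P (fun w => h w * X w) -> intg P (fun w => h w * Z w) ->
  \int[P]_w (h w * Z w) = \int[P]_w (h w * X w).
Proof.
move=> IX /(is_cond_expP _ IX)[mZ IZ ZX] mh IhX IhZ.
apply/eqP; rewrite -subr_eq0 -RintegralB//.
under eq_Rintegral do rewrite -mulrBr.
apply/eqP/(@Rintegral_orthogonal _ _ _ gT _ P idfun measurable_to_g) => //.
- exact: intgB.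
- move=> D; rewrite measurable_gE => GD; have mD := GT GD.
  under eq_Rintegral do rewrite mulrBr.
  by rewrite RintegralB ?ZX ?subrr//; exact: intg_indicM.
- by under eq_fun do rewrite mulrBr; exact: intgB.
Qed.

(** Radon-Nikodym on the coarser space: the charge sending C to the integral of X over C is
    absolutely continuous with respect to the restriction of P to G, which is [Q], the law of the
    identity into that space. *)
Lemma cond_exp_exists (X : T -> R) : intg P X -> exists Z, is_cond_exp P G X Z.
Proof.
move=> IX.
pose i : {mfun T >-> gT} := HB.pack (idfun : T -> gT)
  (isMeasurableFun.Build _ _ _ _ _ measurable_to_g).
pose Q : probability gT R := distribution P i.
pose nu0 : {charge set T -> \bar R} := induced_charge IX.
pose nu : {charge set gT -> \bar R} :=
  measure_function_pushforward__canonical__charge_Charge nu0 measurable_to_g.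
have nuE C : nu C = (\int[P]_(w in C) (X w)%:E)%E by [].
have nuQ : nu `<< Q.
  apply/null_content_dominatesP => C mC QC; rewrite nuE.
  apply: null_set_integral => //.
  - by apply: GT; rewrite -measurable_gE.
  - by apply: measurable_funTS; exact: measurable_int IX.
pose f := Radon_Nikodym nu Q.
have ffin x : f x \is a fin_num by exact: Radon_Nikodym_fin_num.
have If : Q.-integrable setT f by exact: Radon_Nikodym_integrable.
have fE : EFin \o (fine \o f) = f by apply/funext => w /=; rewrite fineK.
have mf : measurable_fun setT f by exact: measurable_int If.
have IfP : P.-integrable setT (f : T -> \bar R).
  apply/integrableP; split; first exact: (measurableT_comp mf measurable_to_g).
  have /integrableP[_] := If.
  by rewrite ge0_integral_distribution//; exact: measurableT_comp.
exists (fine \o f); split.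
- by apply/measurable_EFinP; rewrite fE.
- by rewrite fE.
- move=> C GC; have mC : measurable (C : set gT) by rewrite measurable_gE.
  transitivity (\int[P]_(w in C) f w)%E.
    by apply: eq_integral => w _; rewrite /= fineK.
  rewrite -nuE (Radon_Nikodym_integral nuQ mC).
  rewrite [RHS](@integral_pushforward _ _ _ gT _ _ measurable_to_g P C f) //.
  by apply: integrableS IfP => //; exact: GT.
Qed.

Lemma null_of_pos_integral (W : T -> R) D : measurable D -> intg P W ->
  (forall w, D w -> 0 < W w) -> \int[P]_w (\1_D w * W w) = 0 -> P D = 0.
Proof.
move=> mD IW W0 ID0.
have IDW := intg_indicM mD IW.
have DW0 w : 0 <= \1_D w * W w.
  rewrite indicE; have [|_] := boolP (w \in D); last by rewrite mul0r.
  by rewrite inE mul1r => /W0/ltW.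
have : (\int[P]_w `|(\1_D w * W w)%:E|)%E = 0%E.
  under eq_integral do rewrite gee0_abs ?lee_fin//.
  rewrite -[LHS]fineK; last exact: (integrable_fin_num measurableT IDW).
  by congr EFin.
move=> /(ae_eq_integral_abs P measurableT (measurable_int _ IDW)) ae0.
apply/(negligibleP _ mD); apply: negligibleS ae0 => w Dw /= /(_ I)/=.
by case; rewrite indicE mem_set// mul1r; apply/eqP; rewrite gt_eqF// W0.
Qed.

Lemma intgM_ae (h f : T -> R) (M : R) : measurable_fun setT h ->
  P [set w | M < `|h w|] = 0 -> intg P f -> intg P (fun w => h w * f w).
Proof.
move=> mh N0 If; have mf := intg_measurable If.
have mhf : measurable_fun setT (EFin \o (fun w => h w * f w)).
  by apply/measurable_EFinP; exact: measurable_funM.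
have mN : measurable [set w | M < `|h w|].
  by apply: measurable_set_lt => //; exact: measurableT_comp.
apply/(negligible_integrable mN measurableT mhf N0).
have mC : measurable (setT `\` [set w | M < `|h w|]) by exact: measurableD.
have IMf : intg P (fun w => M * `|f w|) by apply: intgZ; exact: integrable_norm.
apply: (le_integrable mC) (integrableS measurableT mC _ IMf) => //.
  exact: measurable_funTS.
move=> w [_ /= /negP]; rewrite -leNgt => hM; rewrite lee_fin normrM.
by rewrite (le_trans _ (ler_norm _))// ler_wpM2r.
Qed.

(** A version g of a conditional probability is a priori only integrable; this bound makes its
    products with integrable variables integrable, through [intgM_ae]. On {g > 1} the variable g -
    1_b is positive with integral zero, so that set is null; likewise for 1_b - g on {g < 0}. *)
Lemma cond_exp_indic_bounded (b : set T) (g : T -> R) : measurable b ->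
  is_cond_exp P G (\1_b) g -> P [set w | 1 < `|g w|] = 0.
Proof.
move=> mb cg.
have I1 : intg P (\1_b : T -> R).
  apply: (@intg_bounded _ _ _ P (\1_b) 1); first exact: measurable_indic.
  exact: norm_indic_le1.
have [mg Ig gE] := (is_cond_expP _ I1).1 cg.
have G1 : G [set w | 1 < g w] by apply: measurable_wrt_set_lt => //; exact: measurable_cst.
have G0 : G [set w | g w < 0] by apply: measurable_wrt_set_lt => //; exact: measurable_cst.
have m1 := GT G1; have m0 := GT G0.
have P1 : P [set w | 1 < g w] = 0.
  apply: (@null_of_pos_integral (fun w => g w - \1_b w)) => //; first exact: intgB.
    move=> w /= g1; rewrite subr_gt0; apply: le_lt_trans g1.
    by rewrite indicE; case: (_ \in _).
  under eq_Rintegral do rewrite mulrBr.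
  by rewrite RintegralB ?gE ?subrr//; exact: intg_indicM.
have P0 : P [set w | g w < 0] = 0.
  apply: (@null_of_pos_integral (fun w => \1_b w - g w)) => //; first exact: intgB.
    by move=> w /= g0; rewrite subr_gt0 (lt_le_trans g0).
  under eq_Rintegral do rewrite mulrBr.
  by rewrite RintegralB ?gE ?subrr//; exact: intg_indicM.
apply: (@subset_measure0 _ _ _ P _ ([set w | 1 < g w] `|` [set w | g w < 0])).
- apply: measurable_set_lt => //.
  by apply: measurableT_comp => //; exact: measurable_wrt_fun.
- exact: measurableU.
- move=> w /=; have [g0|g0] := ltP (g w) 0; first by right.
  by rewrite ger0_norm//; left.
- exact: null_set_setU.
Qed.

End conditional_expectation.

(** * Causal couplings *)

Lemma sigma_algebra_full (T : Type) (G : set_system T) :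
  sigma_algebra setT G -> G setT.
Proof. by case=> s0 sC _; rewrite -setC0 -setTD; exact: sC. Qed.

(** * Change of variables along a map onto a marginal *)

Section image_probability.
Context d d' (T : measurableType d) (T' : measurableType d') (R : realType).
Context (Q : probability T R) (P : probability T' R) (phi : T -> T').
Hypothesis mphi : measurable_fun setT phi.
Hypothesis QP : forall B, measurable B -> pushforward Q phi B = P B.

Lemma ge0_integral_image (h : T' -> \bar R) : measurable_fun setT h ->
  (forall y, 0 <= h y)%E -> (\int[Q]_x h (phi x) = \int[P]_y h y)%E.
Proof.
move=> mh h0.
rewrite -[LHS](@ge0_integral_pushforward _ _ _ _ _ _ mphi Q setT h)//.
by apply: eq_measure_integral => B mB _; exact: QP.
Qed.

Lemma intg_image (Z : T' -> R) : intg P Z -> intg Q (fun x => Z (phi x)).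
Proof.
move=> /integrableP[mZ Zoo]; apply/integrableP; split.
  exact: (measurableT_comp mZ mphi).
rewrite (@ge0_integral_image (fun y => `|(EFin \o Z) y|%E))//.
exact: measurableT_comp.
Qed.

Lemma Rintegral_image (Z : T' -> R) : intg P Z ->
  \int[Q]_x Z (phi x) = \int[P]_y Z y.
Proof.
move=> IZ; congr fine.
have mZ := measurable_int _ IZ.
rewrite -[LHS](@integral_pushforward _ _ _ _ _ _ mphi Q setT (EFin \o Z))//.
  by apply: eq_measure_integral => B mB _; exact: QP.
exact: intg_image.
Qed.

Context (G : set_system T') (sG : sigma_algebra setT G) (GT : G `<=` measurable).

Notation preim := (preimage_set_system setT phi G).

Lemma sigma_algebra_preim : sigma_algebra setT preim.
Proof. exact: sigma_algebra_preimage. Qed.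

Lemma preim_measurable : preim `<=` measurable.
Proof. by move=> _ [B GB <-]; apply: mphi => //; exact: GT. Qed.

Lemma preim_preimage B : G B -> preim (phi @^-1` B).
Proof. by move=> GB; exists B => //; rewrite setTI. Qed.

Lemma measurable_wrt_preim (h : T' -> R) : measurable_wrt G h ->
  measurable_wrt preim (fun x => h (phi x)).
Proof.
move=> mh _ B mB; rewrite (measurable_gE sigma_algebra_preim) setTI.
apply: (@preim_preimage (h @^-1` B)).
by rewrite -(measurable_gE sG) -[_ @^-1` _]setTI; exact: mh.
Qed.

Lemma is_cond_exp_preim (V C : T' -> R) : intg P V ->
  is_cond_exp P G V C ->
  is_cond_exp Q preim (fun x => V (phi x)) (fun x => C (phi x)).
Proof.
move=> IV /(is_cond_expP GT _ IV)[mC IC CV].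
apply/(is_cond_expP preim_measurable _ (intg_image IV)).
split; [exact: measurable_wrt_preim|exact: intg_image|].
move=> _ [B GB <-]; rewrite setTI; have mB := GT GB.
have := CV _ GB; rewrite -!Rintegral_image//; exact: intg_indicM.
Qed.

End image_probability.

Section causality.
Context (R : realType) (N : nat) (X Y : filteredSpace R N).
Context d (Omega : measurableType d) (Q : probability Omega R).
Context (f : Omega -> X) (g : Omega -> Y).
Hypotheses (mf : measurable_fun setT f) (mg : measurable_fun setT g).
Hypothesis gP : forall B, measurable B -> pushforward Q g B = fs_prob Y B.
Hypothesis caus : forall t, (1 <= t <= N)%N ->
  cond_independent Q (preimage_set_system setT g (fs_filt Y N))
    (preimage_set_system setT f (fs_filt X t))
    (preimage_set_system setT g (fs_filt Y t)).
Context (t : nat) (tN : (1 <= t <= N)%N).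

Let NN : (1 <= N <= N)%N.
Proof. by rewrite leqnn andbT; case/andP: tN => /leq_trans; apply. Qed.

Let sX := fs_filt_sigma_algebra X tN.
Let sY := fs_filt_sigma_algebra Y tN.
Let mX := @fs_filt_measurable _ _ X _ tN.
Let mY := @fs_filt_measurable _ _ Y _ tN.
Let sYN := fs_filt_sigma_algebra Y NN.
Let mYN := @fs_filt_measurable _ _ Y _ NN.

Notation Gl := (preimage_set_system setT g (fs_filt Y t)).
Notation Al := (preimage_set_system setT g (fs_filt Y N)).

Let GA : Gl `<=` Al.
Proof.
move=> _ [B GB <-]; exists B => //; apply: fs_filt_nondecreasing GB.
  by case/andP: tN.
by case/andP: tN => _ ->; rewrite leqnn.
Qed.

Let sG : sigma_algebra setT Gl. Proof. exact: sigma_algebra_preim. Qed.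
Let sA : sigma_algebra setT Al. Proof. exact: sigma_algebra_preim. Qed.
Let mG : Gl `<=` measurable. Proof. exact: preim_measurable. Qed.
Let mA : Al `<=` measurable. Proof. exact: preim_measurable. Qed.

Let wrtM (h k : Omega -> R) : measurable_wrt Gl h -> measurable_wrt Gl k ->
  measurable_wrt Gl (fun w => h w * k w).
Proof. by move=> mh mk; exact: (@measurable_funM _ (g_sigma_algebraType Gl)). Qed.

Let wrt_indic (c : set Omega) : Gl c -> measurable_wrt Gl (\1_c : Omega -> R).
Proof.
move=> Gc; apply: (@measurable_indic _ (g_sigma_algebraType Gl)).
by rewrite measurable_gE.
Qed.

(* [g0], a version of P(a | F_t^Y), is shown to be one of P(a | F_N^Y) as well;
   both sides are then equal to the integral of [g0 * 1_b * V]. *)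
Lemma causal_integral (V C : Y -> R) (a : set X) (b : set Y) :
  intg (fs_prob Y) V -> measurable_wrt (fs_filt Y N) V ->
  is_cond_exp (fs_prob Y) (fs_filt Y t) V C ->
  fs_filt X t a -> fs_filt Y t b ->
  \int[Q]_w (\1_(f @^-1` a) w * (\1_(g @^-1` b) w * V (g w))) =
  \int[Q]_w (\1_(f @^-1` a) w * (\1_(g @^-1` b) w * C (g w))).
Proof.
move=> IV mV cV Xa Yb.
set b' := f @^-1` a; set c := g @^-1` b.
have mb' : measurable b' by rewrite -[b']setTI; apply: mf => //; exact: mX.
have Gc : Gl c by exact: preim_preimage.
have mc := mG Gc.
have IVg := intg_image mg gP IV.
have cVg := is_cond_exp_preim mg gP sY mY IV cV.
have [mCg ICg _] := (is_cond_expP mG _ IVg).1 cVg.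
have mVg : measurable_wrt Al (fun w => V (g w)) by exact: measurable_wrt_preim.
have Ib' : intg Q (\1_b' : Omega -> R) by exact: integrable_indic.
have b'X : preimage_set_system setT f (fs_filt X t) b' by exact: preim_preimage.
have AT : Al setT by exact: sigma_algebra_full.
(* Conditional independence supplies versions that depend on the event of F_N^Y; using it for the
   whole space fixes one version [g0]. *)
have [_ [g0 [_ cg0 _]]] := caus tN AT b'X.
have g0b := cond_exp_indic_bounded sG mG mb' cg0.
have [mg0 Ig0 _] := (is_cond_expP mG _ Ib').1 cg0.
have mg0' := measurable_wrt_fun sG mG mg0.
have Ig0M (h : Omega -> R) : intg Q h -> intg Q (fun w => g0 w * h w).
  by move=> Ih; exact: intgM_ae g0b Ih.
have stepA a' : Al a' ->
    \int[Q]_w (\1_a' w * (\1_c w * g0 w)) = \int[Q]_w (\1_a' w * (\1_c w * \1_b' w)).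
  move=> Aa'; have ma' := mA Aa'.
  have Ia' : intg Q (\1_a' : Omega -> R) by exact: integrable_indic.
  have [f1 [g1 [cf1 cg1 cfg]]] := caus tN Aa' b'X.
  have Iab : intg Q (\1_(a' `&` b') : Omega -> R).
    by apply: integrable_indic; exact: measurableI.
  have [mf1 If1 _] := (is_cond_expP mG _ Ia').1 cf1.
  have [mg1 Ig1 _] := (is_cond_expP mG _ Ib').1 cg1.
  have [_ Ifg fgE] := (is_cond_expP mG _ Iab).1 cfg.
  have mh : measurable_wrt Gl (fun w => \1_c w * f1 w) by exact: (wrtM (wrt_indic Gc) mf1).
  have Ih := intg_indicM mc If1.
  have Ihb : intg Q (fun w => \1_c w * f1 w * \1_b' w).
    by under eq_fun do rewrite mulrC; exact: intg_indicM.
  (* [g0] and the version [g1] attached to [a'] are compared only under the integral: against the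
     F_t^Y-measurable 1_c f1, both give the same value as 1_b'. [E3] then trades f1 for 1_a'. *)
  have E1 : \int[Q]_w (\1_c w * f1 w * g0 w) = \int[Q]_w (\1_c w * f1 w * \1_b' w).
    apply: (cond_exp_pullout sG mG Ib' cg0 mh Ihb).
    by under eq_fun do rewrite mulrC; exact: Ig0M.
  have E2 : \int[Q]_w (\1_c w * f1 w * g1 w) = \int[Q]_w (\1_c w * f1 w * \1_b' w).
    apply: (cond_exp_pullout sG mG Ib' cg1 mh Ihb).
    by under eq_fun do rewrite -mulrA; exact: (intg_indicM mc Ifg).
  have E3 : \int[Q]_w (\1_c w * g0 w * f1 w) = \int[Q]_w (\1_c w * g0 w * \1_a' w).
    apply: (cond_exp_pullout sG mG Ia' cf1).
    - exact: (wrtM (wrt_indic Gc) mg0).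
    - by under eq_fun do rewrite mulrC; exact/intg_indicM/intg_indicM.
    - under eq_fun do rewrite mulrAC mulrC; exact: Ig0M.
  transitivity (\int[Q]_w (\1_c w * g0 w * \1_a' w)).
    by apply: eq_Rintegral => w _; rewrite mulrC.
  rewrite -E3; transitivity (\int[Q]_w (\1_c w * f1 w * g0 w)).
    by apply: eq_Rintegral => w _; rewrite mulrAC.
  rewrite E1 -E2; transitivity (\int[Q]_w (\1_c w * (f1 \* g1) w)).
    by apply: eq_Rintegral => w _; rewrite -mulrA.
  rewrite fgE//; apply: eq_Rintegral => w _.
  by rewrite indicI /= mulrCA.
have mg0A : measurable_wrt Al (fun w => \1_c w * g0 w).
  have mcg : measurable_wrt Gl (fun w => \1_c w * g0 w) by exact: (wrtM (wrt_indic Gc) mg0).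
  move=> _ B mB; rewrite (measurable_gE sA); apply: GA.
  by rewrite -(measurable_gE sG); exact: mcg.
have Icb' := intg_indicM mc Ib'.
have cA : is_cond_exp Q Al (fun w => \1_c w * \1_b' w) (fun w => \1_c w * g0 w).
  by apply/(is_cond_expP mA _ Icb'); split => //; exact: intg_indicM.
(* Three exchanges: 1_b' becomes g0 since V o g is F_N^Y-measurable, V becomes C since 1_c g0 is
   F_t^Y-measurable, and g0 turns back into 1_b' against 1_c C. *)
transitivity (\int[Q]_w (V (g w) * (\1_c w * \1_b' w))).
  by apply: eq_Rintegral => w _; rewrite mulrC -mulrA mulrCA.
rewrite -(cond_exp_pullout sA mA Icb' cA mVg); last 2 first.
- under eq_fun do rewrite mulrC -mulrA mulrCA; apply: intg_indicM => //; exact: intg_indicM.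
- under eq_fun do rewrite mulrC -mulrA mulrCA.
  exact/Ig0M/intg_indicM.
transitivity (\int[Q]_w (\1_c w * g0 w * V (g w))).
  by apply: eq_Rintegral => w _; rewrite mulrC.
rewrite -(cond_exp_pullout sG mG IVg cVg); last 3 first.
- exact: (wrtM (wrt_indic Gc) mg0).
- by under eq_fun do rewrite mulrAC mulrC; exact/Ig0M/intg_indicM.
- by under eq_fun do rewrite mulrAC mulrC; exact/Ig0M/intg_indicM.
transitivity (\int[Q]_w (\1_c w * C (g w) * g0 w)).
  by apply: eq_Rintegral => w _; rewrite mulrAC.
rewrite (cond_exp_pullout sG mG Ib' cg0); last 3 first.
- exact: (wrtM (wrt_indic Gc) mCg).
- by under eq_fun do rewrite mulrC; exact/intg_indicM/intg_indicM.
- by under eq_fun do rewrite mulrC; exact/Ig0M/intg_indicM.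
by apply: eq_Rintegral => w _; rewrite mulrC.
Qed.

(* A measurable function of [joint] is a random variable measurable with respect
   to the join of F_t^X and F_t^Y. *)
Definition joint (w : Omega) :
  g_sigma_algebraType (fs_filt X t) * g_sigma_algebraType (fs_filt Y t) := (f w, g w).

Lemma measurable_joint : measurable_fun setT joint.
Proof.
apply/measurable_fun_pairP; split.
  exact: (measurableT_comp (measurable_to_g sX mX) mf).
exact: (measurableT_comp (measurable_to_g sY mY) mg).
Qed.

(** Dynkin's lemma over measurable rectangles, on which the identity is [causal_integral].
    Complements use [ET]: V and C have the same mean. *)
Lemma causal_joint_integral (V C : Y -> R) D :
  intg (fs_prob Y) V -> measurable_wrt (fs_filt Y N) V ->
  is_cond_exp (fs_prob Y) (fs_filt Y t) V C -> measurable D ->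
  \int[Q]_w (\1_D (joint w) * (V (g w) - C (g w))) = 0.
Proof.
move=> IV mV cV mD.
have [_ IC CV] := (is_cond_expP mY _ IV).1 cV.
have IW := intgB (intg_image mg gP IV) (intg_image mg gP IC).
have IDW E : measurable E -> intg Q (fun w => \1_E (joint w) * (V (g w) - C (g w))).
  move=> mE; apply: (intgM_bounded (M := 1)) => //.
    by apply: (measurableT_comp _ measurable_joint); exact: measurable_indic.
  by move=> w; exact: norm_indic_le1.
have ET : \int[Q]_w (V (g w) - C (g w)) = 0.
  rewrite RintegralB ?(Rintegral_image mg gP)//; try exact: (intg_image mg gP).
  have := CV _ (sigma_algebra_full sY).
  have unit1 (h : Y -> R) : \int[fs_prob Y]_w (\1_setT w * h w) = \int[fs_prob Y]_w h w.
    by apply: eq_Rintegral => w _; rewrite indicT mul1r.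
  by rewrite !unit1 => ->; rewrite subrr.
rewrite measurable_prod_measurableType in mD.
move: D mD.
apply: (dynkin_induction (G := [set A `*` B | A in measurable & B in measurable])
  (P := fun D => \int[Q]_w (\1_D (joint w) * (V (g w) - C (g w))) = 0)).
- exact: measurable_prod_measurableType.
- move=> _ _ [A mA1 [B mB1 <-]] [A' mA' [B' mB' <-]].
  exists (A `&` A'); first exact: measurableI.
  by exists (B `&` B'); [exact: measurableI|rewrite setXI].
- by under eq_Rintegral do rewrite indicT mul1r.
- move=> _ [A mA1 [B mB1 <-]].
  have XA : fs_filt X t A by rewrite -(measurable_gE sX).
  have YB : fs_filt Y t B by rewrite -(measurable_gE sY).
  have E w : \1_(A `*` B) (joint w) * (V (g w) - C (g w)) =
      \1_(f @^-1` A) w * (\1_(g @^-1` B) w * V (g w)) -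
      \1_(f @^-1` A) w * (\1_(g @^-1` B) w * C (g w)).
    rewrite -mulrBr -mulrBr mulrA; congr (_ * _).
    by rewrite !indicE /joint /= in_setX /= -natrM mulnb.
  under eq_Rintegral do rewrite E.
  have mfA : measurable (f @^-1` A) by rewrite -[_ @^-1` _]setTI; apply: mf => //; exact: mX.
  have mgB : measurable (g @^-1` B) by rewrite -[_ @^-1` _]setTI; apply: mg => //; exact: mY.
  rewrite RintegralB ?(causal_integral IV mV cV)// ?subrr//.
    by apply/intg_indicM => //; apply/intg_indicM => //; exact: (intg_image mg gP).
  by apply/intg_indicM => //; apply/intg_indicM => //; exact: (intg_image mg gP).
- move=> S mS S0; have E w : \1_(~` S) (joint w) * (V (g w) - C (g w)) =
      (V (g w) - C (g w)) - \1_S (joint w) * (V (g w) - C (g w)).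
    by rewrite !indicE in_setC; case: (_ \in S); rewrite ?mul1r ?mul0r ?subrr ?subr0.
  under eq_Rintegral do rewrite E.
  by rewrite RintegralB ?IDW// S0 ET subrr.
- move=> F mF tF F0; apply: EFin_inj.
  pose Fj n := joint @^-1` F n.
  have mFj n : measurable (Fj n) by rewrite -[Fj n]setTI; exact: measurable_joint.
  have mU : measurable (\bigcup_n Fj n) by exact: bigcup_measurable.
  have IE E : measurable E -> intg Q (fun w => V (g w) - C (g w)) ->
     (\int[Q]_w (\1_E (joint w) * (V (g w) - C (g w))))%:E =
     (\int[Q]_(w in joint @^-1` E) (V (g w) - C (g w))%:E)%E.
    move=> mE _; rewrite integral_in_indic//.
    by rewrite -[_ @^-1` _]setTI; exact: measurable_joint.
  rewrite IE//; last exact: bigcup_measurable.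
  rewrite preimage_bigcup integral_bigcup//.
  + by rewrite eseries0// => i _ _; rewrite -IE// F0.
  + apply/trivIsetP => i j _ _ ij; rewrite -preimage_setI.
    by move/trivIsetP : tF => /(_ _ _ I I ij) ->; rewrite preimage_set0.
  + exact: integrableS IW.
Qed.

End causality.

(** * Moments and the adapted Wasserstein distance *)

Lemma measurable_nat_sum d (T : measurableType d) (R : realType) (m n : nat)
    (h : nat -> T -> R) :
  (forall t, (m <= t < n)%N -> measurable_fun setT (h t)) ->
  measurable_fun setT (fun w => \sum_(m <= t < n) h t w).
Proof.
(* Terms outside the range are replaced by zero, since nothing is known of a process at times
   outside 1..N. *)
move=> mh; rewrite (_ : (fun w => _) = (fun w =>
    \sum_(m <= t < n) (if (m <= t < n)%N then h t else cst 0) w)).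
  by apply: measurable_sum => t; case: ifPn => [/mh//|_].
by apply/funext => w; apply: eq_big_nat => t ->.
Qed.

Lemma ge0_integral_nat_sum d (T : measurableType d) (R : realType)
    (P : probability T R) (m n : nat) (h : nat -> T -> R) :
  (forall t, (m <= t < n)%N -> measurable_fun setT (h t)) ->
  (forall t w, 0 <= h t w) ->
  (\int[P]_w (\sum_(m <= t < n) h t w)%:E =
   \sum_(m <= t < n) \int[P]_w (h t w)%:E)%E.
Proof.
move=> mh h0; pose h' t := if (m <= t < n)%N then h t else cst 0.
transitivity (\int[P]_w \sum_(m <= t < n) (h' t w)%:E)%E.
  apply: eq_integral => w _; rewrite sumEFin; congr EFin.
  by apply: eq_big_nat => t; rewrite /h' => ->.
rewrite ge0_integral_sum//; last 2 first.
- by move=> t; apply/measurable_EFinP; rewrite /h'; case: ifPn => [/mh|].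
- by move=> t w _; rewrite lee_fin /h'; case: ifPn.
by apply: eq_big_nat => t tmn; apply: eq_integral => w _; rewrite /h' tmn.
Qed.

Section Lp_moment.
Context d (T : measurableType d) (R : realType) (P : probability T R).
Context (p : R) (p_ge1 : 1 <= p).

Let p_gt0 : 0 < p. Proof. exact: lt_le_trans p_ge1. Qed.

(** |a + b| is at most twice the larger of |a| and |b|, and the p-th power of the larger is at most
    the sum of the p-th powers. *)
Lemma powR_normD (a b : R) : `|a + b| `^ p <= 2 `^ p * (`|a| `^ p + `|b| `^ p).
Proof.
apply: (@le_trans _ _ ((2 * Num.max `|a| `|b|) `^ p)).
  rewrite ge0_ler_powR ?nnegrE ?(ltW p_gt0)// ?mulr_ge0 ?le_max ?normr_ge0//.
  apply: le_trans (ler_normD _ _) _; rewrite mulr_natl mulr2n.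
  by rewrite lerD// le_max lexx ?orbT.
rewrite powRM// ?le_max ?normr_ge0//.
rewrite ler_wpM2l ?powR_ge0//; case: (leP `|a| `|b|) => _.
  by rewrite lerDr powR_ge0.
by rewrite lerDl powR_ge0.
Qed.

Lemma Lp_momentD (h k : T -> R) :
  measurable_fun setT h -> measurable_fun setT k ->
  (\int[P]_w (`|h w + k w| `^ p)%:E <= (2 `^ p)%:E *
    (\int[P]_w (`|h w| `^ p)%:E + \int[P]_w (`|k w| `^ p)%:E))%E.
Proof.
move=> mh mk; have mp (l : T -> R) : measurable_fun setT l ->
    measurable_fun setT (fun w => (`|l w| `^ p)%:E).
  by move=> ml; apply/measurable_EFinP; exact: measurable_norm_powR.
have p0 (l : T -> R) w : setT w -> (0 <= (`|l w| `^ p)%:E)%E.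
  by rewrite lee_fin powR_ge0.
rewrite -(ge0_integralD P measurableT (p0 h) (mp h mh) (p0 k) (mp k mk)).
rewrite -ge0_integralZl//; last 2 first.
- by apply: emeasurable_funD; exact: mp.
- by move=> w _; rewrite adde_ge0 ?lee_fin ?powR_ge0.
apply: ge0_le_integral => //.
- by apply: mp; exact: measurable_funD.
- by apply: measurable_funeM; apply: emeasurable_funD; exact: mp.
- by move=> w _; rewrite lee_fin powR_normD.
Qed.

(** For p >= 1, |h| <= 1 + |h|^p, and constants are integrable under a probability. *)
Lemma intg_Lp (h : T -> R) (S : T -> R) : measurable_fun setT h ->
  (forall w, `|h w| `^ p <= S w) -> intg P S -> intg P h.
Proof.
move=> mh hS IS; apply: (@intg_le _ _ _ _ _ (fun w => 1 + S w)) => //; last first.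
  by apply: intgD => //; exact: finite_measure_integrable_cst.
move=> w; have [h1|h1] := leP `|h w| 1.
  by rewrite (le_trans h1)// lerDl (le_trans _ (hS w))// powR_ge0.
rewrite (@le_trans _ _ (S w)) ?lerDr// (le_trans _ (hS w))//.
by rewrite -[leLHS]powRr1// ler_powR// ltW.
Qed.

End Lp_moment.

Section adapted_wasserstein_cost.
Context (R : realType) (N : nat) d (E : measurableType d).
Context (c : E -> E -> R) (p : R) (p_ge1 : 1 <= p) (X Y : filteredProcess R N E).
Hypothesis c0 : forall x y, 0 <= c x y.

Let p_gt0 : 0 < p. Proof. exact: lt_le_trans p_ge1. Qed.

Definition transport_cost (pi : probability (X * Y)%type R) : \bar R :=
  (\int[pi]_w (\sum_(1 <= t < N.+1) c (fp_val X t w.1) (fp_val Y t w.2))%:E)%E.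

Let inf_ge0 :
  (0 <= ereal_inf [set transport_cost pi | pi in bicausal_couplings (X:=X) (Y:=Y)])%E.
Proof.
apply: le_ereal_inf_tmp => _ [pi _ <-].
by apply: integral_ge0 => w _; rewrite lee_fin sumr_ge0.
Qed.

Let AW_costE : AW_cost c p X Y =
  (ereal_inf [set transport_cost pi | pi in bicausal_couplings (X:=X) (Y:=Y)] `^ p^-1)%E.
Proof. by rewrite /AW_cost unlock. Qed.

Lemma AW_cost_ge0 : (0 <= AW_cost c p X Y)%E.
Proof. exact: poweR_ge0. Qed.

(** No optimal coupling is assumed to exist: a strict bound on the distance yields a near-optimal
    one, and undoes the p-th root at the same time. *)
Lemma AW_cost_lt (del : R) : (AW_cost c p X Y < del%:E)%E ->
  exists2 pi, bicausal_couplings pi & (transport_cost pi < (del `^ p)%:E)%E.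
Proof.
rewrite AW_costE => Hlt.
have del0 : 0 < del by rewrite -lte_fin; exact: le_lt_trans (poweR_ge0 _ _) Hlt.
have : (ereal_inf [set transport_cost pi | pi in bicausal_couplings (X:=X) (Y:=Y)]
    < (del `^ p)%:E)%E.
  rewrite ltNge; apply/negP => Hle; move: Hlt; rewrite ltNge => /negP; apply.
  rewrite (_ : del%:E = ((del `^ p)%:E `^ p^-1)%E); last first.
    by rewrite poweR_EFin -powRrM mulfV ?gt_eqF// powRr1// ltW.
  apply: gt0_ler_poweR Hle; rewrite ?in_itv/= ?leey ?andbT ?invr_ge0 ?(ltW p_gt0)//.
  by rewrite lee_fin powR_ge0.
by move=> /ereal_inf_lt[_ [pi bpi <-]]; exists pi.
Qed.

Lemma AW_cost_le (del : R) (pi : probability (X * Y)%type R) : 0 <= del ->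
  bicausal_couplings pi ->
  (transport_cost pi <= (del `^ p)%:E)%E -> (AW_cost c p X Y <= del%:E)%E.
Proof.
move=> del0 bpi Hle; rewrite AW_costE.
rewrite (_ : del%:E = ((del `^ p)%:E `^ p^-1)%E); last first.
  by rewrite poweR_EFin -powRrM mulfV ?gt_eqF// powRr1.
apply: gt0_ler_poweR; rewrite ?in_itv/= ?leey ?andbT ?invr_ge0 ?(ltW p_gt0)// ?lee_fin ?powR_ge0//.
by apply: le_trans Hle; apply: ereal_inf_lbound; exists pi.
Qed.

End adapted_wasserstein_cost.

(** Lets a Lipschitz bound be proved for each del above the distance, where a coupling of cost below
    del^p exists. The slack e / L absorbs the passage to the infimum; L > 0 settles an infinite
    distance. *)
Lemma le_mule_of_lt (R : realType) (x a : \bar R) (L : R) : 0 < L -> (0 <= a)%E ->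
  (forall del : R, (a < del%:E)%E -> (x <= (L * del)%:E)%E) -> (x <= L%:E * a)%E.
Proof.
move=> L0; move: a => [a|_ _|]//; last by rewrite mulry gtr0_sg// mul1e leey.
rewrite lee_fin => a0 H; apply/lee_addgt0Pr => e e0.
have := H (a + e / L); rewrite lte_fin ltrDl divr_gt0// => /(_ isT).
by rewrite mulrDr mulrCA mulfV ?mulr1 ?gt_eqF.
Qed.

(** * Doob decomposition *)

Lemma measurable_wrt_sub (T : pointedType) (R : realType) (G G' : set_system T)
    (d : measure_display) (E : measurableType d)
    (f : g_sigma_algebraType G -> E) :
  sigma_algebra setT G -> sigma_algebra setT G' -> G `<=` G' ->
  measurable_fun setT f -> measurable_fun setT (f : g_sigma_algebraType G' -> E).
Proof.
move=> sG sG' GG' mf _ B mB; rewrite measurable_g_measurableTypeE//; apply: GG'.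
by rewrite -(measurable_g_measurableTypeE sG); exact: mf.
Qed.

Section doob_existence.
Context (R : realType) (N : nat) (p : R) (p_ge1 : 1 <= p).
Context (X : filteredProcess R N R) (FPX : FP p X).
Notation P := (fs_prob X).

Let sF t (tN : (1 <= t <= N)%N) := fs_filt_sigma_algebra X tN.
Let mF t (tN : (1 <= t <= N)%N) := @fs_filt_measurable _ _ X _ tN.

Lemma fp_val_measurable t : (1 <= t <= N)%N -> measurable_fun setT (fp_val X t).
Proof.
by move=> tN; apply: (measurable_wrt_fun (sF tN) (mF tN)); exact: fp_adapted.
Qed.

Lemma fp_val_intg t : (1 <= t <= N)%N -> intg P (fp_val X t).
Proof.
move=> tN; pose S w := \sum_(1 <= s < N.+1) `|fp_val X s w| `^ p.
have S0 w : 0 <= S w by apply: sumr_ge0 => s _; exact: powR_ge0.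
apply: (@intg_Lp _ _ _ _ _ p_ge1 _ S); first exact: fp_val_measurable.
  move=> w; rewrite /S (big_rem t) ?mem_index_iota//=.
  by rewrite lerDl sumr_ge0// => s _; exact: powR_ge0.
apply/integrableP; split.
  apply/measurable_EFinP; apply: measurable_nat_sum => s sN.
  by apply: measurable_norm_powR; exact: fp_val_measurable.
move: FPX; rewrite /FP unlock; apply: le_lt_trans.
by under eq_integral do rewrite /= ger0_norm//.
Qed.

Let wrt_sub s t (f : X -> R) : (1 <= s)%N -> (s <= t <= N)%N ->
  measurable_wrt (fs_filt X s) f -> measurable_wrt (fs_filt X t) f.
Proof.
move=> s1 /andP[st tN]; apply: measurable_wrt_sub => //.
- by apply: sF; rewrite s1 (leq_trans st).
- by apply: sF; rewrite (leq_trans s1 st).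
- by apply: fs_filt_nondecreasing => //; rewrite st.
Qed.

Let wrtB t (f g : X -> R) : measurable_wrt (fs_filt X t) f ->
  measurable_wrt (fs_filt X t) g -> measurable_wrt (fs_filt X t) (fun w => f w - g w).
Proof. exact: (@measurable_funB _ (g_sigma_algebraType (fs_filt X t))). Qed.

Let wrtD t (f g : X -> R) : measurable_wrt (fs_filt X t) f ->
  measurable_wrt (fs_filt X t) g -> measurable_wrt (fs_filt X t) (fun w => f w + g w).
Proof. exact: (@measurable_funD _ (g_sigma_algebraType (fs_filt X t))). Qed.

Lemma doob_decomposition_exists :
  exists M A : nat -> X -> R, doob_decomposition M A.
Proof.
have /choice[C CP] : forall t, exists Z : X -> R, (1 <= t < N)%N ->
    is_cond_exp P (fs_filt X t) (fp_val X t.+1) Z.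
  move=> t; case: (boolP (1 <= t < N)%N) => [/andP[t1 tN]|_]; last by exists (cst 0).
  have [|||Z ZP] := @cond_exp_exists _ _ _ P (fs_filt X t) _ _ (fp_val X t.+1).
  - by apply: sF; rewrite t1 ltnW.
  - by apply: mF; rewrite t1 ltnW.
  - exact: fp_val_intg.
  - by exists Z.
(* The classical compensator, with increments E[X_(s+1) | F_s] - X_s. *)
pose A t w := \sum_(1 <= s < t) (C s w - fp_val X s w).
have A1 w : A 1%N w = 0 by rewrite /A big_geq.
have AS t w : (1 <= t)%N -> A t.+1 w = A t w + (C t w - fp_val X t w).
  by move=> t1; rewrite /A big_nat_recr.
have CE t (tN : (1 <= t < N)%N) : [/\ measurable_wrt (fs_filt X t) (C t),
    intg P (C t) & forall B, fs_filt X t B ->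
    \int[P]_w (\1_B w * C t w) = \int[P]_w (\1_B w * fp_val X t.+1 w)].
  have tN' : (1 <= t <= N)%N by case/andP: tN => -> /ltnW.
  have tN1 : (1 <= t.+1 <= N)%N by case/andP: tN.
  exact: ((is_cond_expP (mF tN') _ (fp_val_intg tN1)).1 (CP _ tN)).
have Apr t : (1 <= t < N)%N -> measurable_wrt (fs_filt X t) (A t.+1) /\ intg P (A t.+1).
  elim: t => // t IH tN.
  have [mC IC _] := CE _ tN.
  have tN' : (1 <= t.+1 <= N)%N by exact: ltnW.
  have mX := @fp_adapted _ _ _ _ X _ tN'.
  have IX := fp_val_intg tN'.
  rewrite (_ : A t.+2 = fun w => A t.+1 w + (C t.+1 w - fp_val X t.+1 w)); last first.
    by apply/funext => w; rewrite AS.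
  (* [A 1] is treated apart: F_0 is unconstrained and the induction hypothesis is void there. *)
  case: t => [|t] in IH tN mC IC tN' mX IX *.
    rewrite (_ : A 1%N = cst 0); last exact/funext.
    split; last by apply: intgD; [exact: finite_measure_integrable_cst|exact: intgB].
    by apply: wrtD; [exact: measurable_cst|exact: wrtB].
  have [mA IA] := IH (ltnW tN).
  split; last by apply: intgD => //; exact: intgB.
  apply: wrtD; last exact: wrtB.
  by apply: wrt_sub mA => //; rewrite leqnSn.
have Aad t : (1 <= t <= N)%N -> measurable_wrt (fs_filt X t) (A t) /\ intg P (A t).
  case: t => [//|[|t]] tN.
    rewrite (_ : A 1%N = cst 0); last exact/funext.
    by split; [exact: measurable_cst|exact: finite_measure_integrable_cst].
  have [mA IA] := Apr t.+1 tN; split => //.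
  by apply: wrt_sub mA => //; rewrite leqnSn.
exists (fun t w => fp_val X t w - A t w), A; split => //.
- by move=> t tN w; rewrite subrK.
- split.
  + by move=> t tN; apply: wrtB; [exact: fp_adapted|exact: (Aad _ tN).1].
  + by move=> t tN; apply: intgB; [exact: fp_val_intg|exact: (Aad _ tN).2].
  + move=> t tN; have tN' : (1 <= t <= N)%N by case/andP: tN => -> /ltnW.
    have tN1 : (1 <= t.+1 <= N)%N by case/andP: tN.
    have [mC IC CX] := CE _ tN; have [mA IA] := Aad _ tN'.
    have [mA1 IA1] := Aad _ tN1.
    have IX := fp_val_intg tN'; have IX1 := fp_val_intg tN1.
    have mX := @fp_adapted _ _ _ _ X _ tN'.
    apply/(is_cond_expP (mF tN')); first exact: intgB.
    split; [exact: wrtB|exact: intgB|].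
    move=> B FB; have mB := mF tN' FB; have t1 : (1 <= t)%N by case/andP: tN.
    (* The martingale increment is X_(t+1) - C_t, which integrates to zero over each set of F_t. *)
    have E w : \1_B w * (fp_val X t.+1 w - A t.+1 w) =
      \1_B w * (fp_val X t w - A t w) +
      (\1_B w * fp_val X t.+1 w - \1_B w * C t w) by rewrite AS//; ring.
    under [RHS]eq_Rintegral do rewrite E.
    rewrite RintegralD//; last 2 first.
    * by apply: intg_indicM => //; exact: intgB.
    * by apply: intgB; exact: intg_indicM.
    by rewrite RintegralB ?CX ?subrr ?addr0//; exact: intg_indicM.
- by move=> t tN; exact: (Apr _ tN).1.
Qed.

(** E[M_(t+1) | F_t] = M_t, and A_(t+1) is already F_t-measurable. This turns any given
    decomposition into conditional expectations, to which the contraction applies. *)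
Lemma doob_cond_exp (M A : nat -> X -> R) t : doob_decomposition M A ->
  (1 <= t < N)%N ->
  is_cond_exp P (fs_filt X t) (fp_val X t.+1) (fun w => M t w + A t.+1 w).
Proof.
move=> [XMA _ [mM IM cM] pA] tN.
have tN' : (1 <= t <= N)%N by case/andP: tN => -> /ltnW.
have tN1 : (1 <= t.+1 <= N)%N by case/andP: tN.
have IX1 := fp_val_intg tN1.
have IM1 := IM _ tN1.
have IA : intg P (A t.+1).
  rewrite (_ : A t.+1 = fun w => fp_val X t.+1 w - M t.+1 w); first exact: intgB.
  by apply/funext => w; rewrite XMA// addrAC subrr add0r.
have [mM' IM' ME] := (is_cond_expP (mF tN') _ IM1).1 (cM _ tN).
apply/(is_cond_expP (mF tN') _ IX1); split.
- by apply: wrtD => //; exact: pA.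
- exact: intgD.
- move=> B FB; have mB := mF tN' FB.
  under eq_Rintegral do rewrite mulrDr.
  rewrite RintegralD ?ME//; [|exact: intg_indicM|exact: intg_indicM].
  rewrite -RintegralD//; [|exact: intg_indicM|exact: intg_indicM].
  by apply: eq_Rintegral => w _; rewrite -mulrDr XMA.
Qed.

Lemma doob_predictable_intg (M A : nat -> X -> R) t : doob_decomposition M A ->
  (1 <= t <= N)%N -> intg P (A t) /\ intg P (M t).
Proof.
move=> [XMA _ [mM IM cM] pA] tN; split; last exact: IM.
rewrite (_ : A t = fun w => fp_val X t w - M t w).
  by apply: intgB; [exact: fp_val_intg|exact: IM].
by apply/funext => w; rewrite XMA// addrAC subrr add0r.
Qed.

End doob_existence.

Section bicausal_contraction.
Context (R : realType) (N : nat) (X Y : filteredSpace R N).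
Context (pi : probability (X * Y)%type R) (bpi : bicausal_couplings pi).

Lemma coupling_fst B : measurable B -> pushforward pi fst B = fs_prob X B.
Proof. by move=> mB; have [[+ _] _ _] := bpi; apply. Qed.

Lemma coupling_snd B : measurable B -> pushforward pi snd B = fs_prob Y B.
Proof. by move=> mB; have [[_ +] _ _] := bpi; apply. Qed.

(** [integral_contraction] for V - V' and u(x, y) = C x - C' y on the product of the spaces
    coarsened to time t. Causality gives the orthogonality of V - C, anticausality that of V' -
    C'. *)
Lemma bicausal_contraction (p : R) t (V C : X -> R) (V' C' : Y -> R) :
  1 <= p -> (1 <= t <= N)%N ->
  intg (fs_prob X) V -> measurable_wrt (fs_filt X N) V ->
  is_cond_exp (fs_prob X) (fs_filt X t) V C ->
  intg (fs_prob Y) V' -> measurable_wrt (fs_filt Y N) V' ->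
  is_cond_exp (fs_prob Y) (fs_filt Y t) V' C' ->
  (\int[pi]_w (`|C w.1 - C' w.2| `^ p)%:E <=
   (2 `^ p)%:E * \int[pi]_w (`|V w.1 - V' w.2| `^ p)%:E)%E.
Proof.
move=> p1 tN IV mV cV IV' mV' cV'; have [cpl cau anti] := bpi.
have [mC IC _] := (is_cond_expP (@fs_filt_measurable _ _ X _ tN) _ IV).1 cV.
have [mC' IC' _] := (is_cond_expP (@fs_filt_measurable _ _ Y _ tN) _ IV').1 cV'.
have m1 := @measurable_fst _ _ X Y; have m2 := @measurable_snd _ _ X Y.
pose gX := g_sigma_algebraType (fs_filt X t).
pose gY := g_sigma_algebraType (fs_filt Y t).
pose phi (w : X * Y) : gX * gY := joint fst snd t w.
have mphi : measurable_fun setT phi by exact: measurable_joint.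
pose u (z : gX * gY) : R := C z.1 - C' z.2.
have mu : measurable_fun setT u.
  by apply: measurable_funB; [exact: (measurableT_comp mC measurable_fst)
                             |exact: (measurableT_comp mC' measurable_snd)].
have IVf := intg_image m1 coupling_fst IV.
have ICf := intg_image m1 coupling_fst IC.
have IVs := intg_image m2 coupling_snd IV'.
have ICs := intg_image m2 coupling_snd IC'.
apply: (@integral_contraction _ _ _ (gX * gY)%type _ pi phi mphi p p1 u
  (fun w => V w.1 - V' w.2) mu).
- exact: intgB.
- exact: (intgB ICf ICs).
- move=> D mD; have mpD : measurable (phi @^-1` D) by rewrite -[_ @^-1` _]setTI; exact: mphi.
  (* The causal half is [causal_joint_integral] with X and Y exchanged, which also exchanges the
     coordinates of [joint]. *)
  pose D' : set (gY * gX) := [set z | D (z.2, z.1)].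
  have mD' : measurable D'.
    have ms : measurable_fun setT (fun z : gY * gX => (z.2, z.1) : gX * gY).
      by apply: measurable_fun_pair; [exact: measurable_snd|exact: measurable_fst].
    by rewrite -[D']setTI; exact: ms.
  have E w : \1_D (phi w) * (V w.1 - V' w.2 - u (phi w)) =
     \1_D' (joint snd fst t w) * (V w.1 - C w.1) -
     \1_D (phi w) * (V' w.2 - C' w.2).
    rewrite [\1_D' _](_ : _ = \1_D (phi w)); last by rewrite !indicE.
    by rewrite /u /=; ring.
  under eq_Rintegral do rewrite E.
  rewrite RintegralB//; last 2 first.
  + exact: (@intg_indicM _ _ _ pi (phi @^-1` D)  _ mpD (intgB IVf ICf)).
  + exact: (@intg_indicM _ _ _ pi (phi @^-1` D)  _ mpD (intgB IVs ICs)).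
  rewrite (causal_joint_integral m2 m1 coupling_fst cau tN IV mV cV mD').
  by rewrite (causal_joint_integral m1 m2 coupling_snd anti tN IV' mV' cV' mD) subrr.
Qed.

End bicausal_contraction.

(** * Lipschitz continuity of the Doob decomposition *)

Section doob_lipschitz.
Context (R : realType) (N : nat) (p : R) (N_gt0 : (0 < N)%N) (p_ge1 : 1 <= p).

Let k := 2 `^ p : R.

Let k0 : 0 <= k. Proof. exact: powR_ge0. Qed.

(** The value at t bounds the p-th moment of A_(t+1) - A'_(t+1) in units of the transport cost; it
    is 0 at t = 0 since A_1 = 0. In the recursion the outer k splits a sum of two terms, the first
    inner k is the contraction, and k * (1 + c) bounds the difference of the martingale parts. *)
Fixpoint compensator_constant t : R :=
  if t is t'.+1 then k * (k + k * (1 + compensator_constant t')) else 0.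

Let c := compensator_constant.

Let c0 t : 0 <= c t.
Proof. by elim: t => //= t IH; rewrite !(mulr_ge0, addr_ge0). Qed.

Section one_coupling.
Context (X Y : filteredProcess R N R) (FPX : FP p X) (FPY : FP p Y).
Context (M A : nat -> X -> R) (hX : doob_decomposition M A).
Context (M' A' : nat -> Y -> R) (hY : doob_decomposition M' A').
Context (pi : probability (X * Y)%type R) (bpi : bicausal_couplings pi).

Let cost := transport_cost (fun x y : R => `|x - y| `^ p) pi.

Let Lp (f : X * Y -> R) : \bar R := (\int[pi]_w (`|f w| `^ p)%:E)%E.

Let Lp0 f : (0 <= Lp f)%E.
Proof. by apply: integral_ge0 => w _; rewrite lee_fin powR_ge0. Qed.

Let del t (w : X * Y) := fp_val X t w.1 - fp_val Y t w.2.
Let dA t (w : X * Y) := A t w.1 - A' t w.2.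
Let dM t (w : X * Y) := M t w.1 - M' t w.2.

Let m_fst (f : X -> R) : measurable_fun setT f -> measurable_fun setT (fun w : X * Y => f w.1).
Proof. by move=> mf; exact: (measurableT_comp mf measurable_fst). Qed.

Let m_snd (f : Y -> R) : measurable_fun setT f -> measurable_fun setT (fun w : X * Y => f w.2).
Proof. by move=> mf; exact: (measurableT_comp mf measurable_snd). Qed.

Let mdel t : (1 <= t <= N)%N -> measurable_fun setT (del t).
Proof.
by move=> tN; apply: measurable_funB; [apply: m_fst|apply: m_snd];
  exact: fp_val_measurable.
Qed.

Let mdA t : (1 <= t <= N)%N -> measurable_fun setT (dA t).
Proof.
move=> tN; apply: measurable_funB; [apply: m_fst|apply: m_snd].
  exact: intg_measurable (doob_predictable_intg p_ge1 FPX hX tN).1.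
exact: intg_measurable (doob_predictable_intg p_ge1 FPY hY tN).1.
Qed.

Let mdM t : (1 <= t <= N)%N -> measurable_fun setT (dM t).
Proof.
move=> tN; apply: measurable_funB; [apply: m_fst|apply: m_snd].
  exact: intg_measurable (doob_predictable_intg p_ge1 FPX hX tN).2.
exact: intg_measurable (doob_predictable_intg p_ge1 FPY hY tN).2.
Qed.

Let del_cost t : (1 <= t <= N)%N -> (Lp (del t) <= cost)%E.
Proof.
move=> tN; apply: ge0_le_integral => //.
- by apply/measurable_EFinP/measurable_norm_powR; exact: mdel.
- apply/measurable_EFinP/measurable_nat_sum => s sN.
  by apply: measurable_norm_powR; exact: mdel.
- move=> w _; rewrite lee_fin (big_rem t) ?mem_index_iota//=.
  by rewrite lerDl sumr_ge0// => s _; exact: powR_ge0.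
Qed.

Let dM_le t : (1 <= t <= N)%N -> (Lp (dM t) <= k%:E * (Lp (del t) + Lp (dA t)))%E.
Proof.
move=> tN; rewrite (_ : Lp (dM t) = Lp (fun w => del t w + - dA t w)).
  rewrite (_ : Lp (dA t) = Lp (fun w => - dA t w)).
    by apply: (Lp_momentD pi p_ge1 (mdel tN)); exact: measurable_funN (mdA tN).
  by apply: eq_integral => w _; rewrite normrN.
have [XMA _ _ _] := hX; have [YMA _ _ _] := hY.
apply: eq_integral => w _; congr (`|_| `^ p)%:E.
by rewrite /dM /del /dA XMA// YMA//; ring.
Qed.

Let dA_le t : (t < N)%N -> (Lp (dA t.+1) <= (c t)%:E * cost)%E.
Proof.
elim: t => [|t IH] tN.
  rewrite mul0e /Lp; under eq_integral => w _.
    rewrite /dA; have [_ -> _ _] := hX; have [_ -> _ _] := hY.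
    rewrite subrr normr0 powR0 ?gt_eqF ?(lt_le_trans _ p_ge1)//; over.
  by rewrite integral0.
have tN1 : (1 <= t.+1 <= N)%N by exact: ltnW.
have tN2 : (1 <= t.+2 <= N)%N by [].
(* [U] is the difference of the conditional expectations of X_(t+2) and Y_(t+2) at time t+1, and
   dA_(t+2) = U - dM_(t+1): the contraction bounds [U], the induction hypothesis bounds [dM] through
   dM = del - dA. *)
pose U w := (M t.+1 w.1 + A t.+2 w.1) - (M' t.+1 w.2 + A' t.+2 w.2).
have mU : measurable_fun setT U.
  rewrite (_ : U = fun w => dM t.+1 w + dA t.+2 w); last first.
    by apply/funext => w; rewrite /U /dM /dA; ring.
  by apply: measurable_funD; [exact: mdM|exact: mdA].
have wrtN (Z : filteredProcess R N R) : measurable_wrt (fs_filt Z N) (fp_val Z t.+2).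
  apply: (@measurable_wrt_sub _ R (fs_filt Z t.+2)); last exact: fp_adapted.
  - exact: fs_filt_sigma_algebra.
  - by apply: fs_filt_sigma_algebra; rewrite N_gt0 leqnn.
  - by apply: fs_filt_nondecreasing; rewrite // tN leqnn.
have LU : (Lp U <= k%:E * cost)%E.
  apply: (@le_trans _ _ (k%:E * Lp (del t.+2))%E); last first.
    by apply: lee_wpmul2l; rewrite ?lee_fin//; exact: del_cost.
  apply: (@bicausal_contraction _ _ _ _ pi bpi p t.+1 (fp_val X t.+2)
    (fun x => M t.+1 x + A t.+2 x) (fp_val Y t.+2)
    (fun y => M' t.+1 y + A' t.+2 y)) => //.
  - exact: (fp_val_intg p_ge1).
  - exact: (doob_cond_exp p_ge1).
  - exact: (fp_val_intg p_ge1).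
  - exact: (doob_cond_exp p_ge1).
rewrite (_ : Lp (dA t.+2) = Lp (fun w => U w + - dM t.+1 w)); last first.
  by apply: eq_integral => w _; congr (`|_| `^ p)%:E; rewrite /U /dM /dA; ring.
apply: le_trans (Lp_momentD _ p_ge1 mU (measurable_funN (mdM tN1))) _.
rewrite (_ : (\int[pi]_w (`|- dM t.+1 w| `^ p)%:E)%E = Lp (dM t.+1)); last first.
  by apply: eq_integral => w _; rewrite normrN.
have LM : (Lp (dM t.+1) <= k%:E * ((1 + c t)%:E * cost))%E.
  apply: le_trans (dM_le tN1) _; apply: lee_wpmul2l; rewrite ?lee_fin//.
  rewrite EFinD ge0_muleDl ?lee_fin// mul1e; apply: leeD; first exact: del_cost.
  exact: IH (ltnW tN).
rewrite /c /= -/c EFinM -muleA; apply: lee_wpmul2l; rewrite ?lee_fin//.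
rewrite EFinD ge0_muleDl ?lee_fin ?(mulr_ge0, addr_ge0)//; apply: leeD => //.
by rewrite EFinM -muleA.
Qed.

Lemma doob_transport_cost :
  (transport_cost (X := doob_process hX) (Y := doob_process hY)
     (fun x y : R * R => (`|x.1 - y.1| `^ p + `|x.2 - y.2| `^ p)%R) pi
   <= (\sum_(1 <= t < N.+1) (k * (1 + c t.-1) + c t.-1))%:E * cost)%E.
Proof.
have cost0 : (0 <= cost)%E.
  by apply: integral_ge0 => w _; rewrite lee_fin sumr_ge0// => t _; exact: powR_ge0.
rewrite /transport_cost /= (@ge0_integral_nat_sum _ _ _ pi 1 N.+1
  (fun t w => `|dM t w| `^ p + `|dA t w| `^ p)); last 2 first.
- move=> t tN; apply: measurable_funD; apply: measurable_norm_powR.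
    exact: mdM.
  exact: mdA.
- by move=> t w; rewrite addr_ge0// powR_ge0.
rewrite -sumEFin ge0_sume_distrl; last first.
  by move=> t _; rewrite lee_fin !(mulr_ge0, addr_ge0).
rewrite [leLHS]big_nat_cond [leRHS]big_nat_cond.
apply: lee_sum => t /andP[tN _].
rewrite (_ : (\int[pi]_w _)%E = (Lp (dM t) + Lp (dA t))%E); last first.
  under eq_integral do rewrite EFinD.
  rewrite ge0_integralD//.
  - by apply/measurable_EFinP/measurable_norm_powR; exact: mdM.
  - by apply/measurable_EFinP/measurable_norm_powR; exact: mdA.
have LA : (Lp (dA t) <= (c t.-1)%:E * cost)%E.
  by case: t tN => // t tN; exact: dA_le.
rewrite EFinD ge0_muleDl ?lee_fin ?(mulr_ge0, addr_ge0)//; apply: leeD => //.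
apply: le_trans (dM_le tN) _; rewrite EFinM -muleA; apply: lee_wpmul2l; rewrite ?lee_fin//.
by rewrite EFinD ge0_muleDl ?lee_fin// mul1e; apply: leeD => //; exact: del_cost.
Qed.

End one_coupling.

(** [doob_process] keeps the filtered space, so a near-optimal bicausal coupling of X and Y is
    reused unchanged for their Doob processes. *)
Lemma doob_lipschitz : exists2 L : R, 0 <= L &
  forall X Y : filteredProcess R N R, FP p X -> FP p Y ->
  forall (M A : nat -> X -> R) (hX : doob_decomposition M A)
         (M' A' : nat -> Y -> R) (hY : doob_decomposition M' A'),
    (AW2 p (doob_process hX) (doob_process hY) <= L%:E * AW p X Y)%E.
Proof.
have p_gt0 : 0 < p by exact: lt_le_trans p_ge1.
(* The added 1 keeps K positive for [le_mule_of_lt]; costs are p-th powers, whence the constant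
   K^(1/p). *)
pose K := 1 + \sum_(1 <= t < N.+1) (k * (1 + c t.-1) + c t.-1).
have K0 : 0 < K.
  by rewrite ltr_pwDl// sumr_ge0// => t _; rewrite !(mulr_ge0, addr_ge0).
exists (K `^ p^-1); first exact: powR_ge0.
move=> X Y FPX FPY M A hX M' A' hY.
have c1 (x y : R) : 0 <= `|x - y| `^ p by exact: powR_ge0.
have c2 (x y : R * R) : 0 <= `|x.1 - y.1| `^ p + `|x.2 - y.2| `^ p.
  by rewrite addr_ge0// powR_ge0.
apply: le_mule_of_lt; first exact: powR_gt0.
  exact: AW_cost_ge0.
move=> del Hdel; have [pi bpi Hpi] := AW_cost_lt p_ge1 c1 Hdel.
have del0 : 0 <= del by rewrite -lee_fin ltW// (le_lt_trans _ Hdel)// AW_cost_ge0.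
apply: (@AW_cost_le _ _ _ _ _ _ p_ge1 (doob_process hX) (doob_process hY) c2 _ pi) => //.
  by rewrite mulr_ge0 ?powR_ge0.
apply: le_trans (doob_transport_cost FPX FPY hX hY bpi) _.
rewrite powRM ?powR_ge0// -powRrM mulVf ?gt_eqF// powRr1 ?(ltW K0)// EFinM.
apply: lee_pmul; rewrite ?lee_fin//.
- by rewrite sumr_ge0// => t _; rewrite !(mulr_ge0, addr_ge0).
- by apply: integral_ge0 => w _; rewrite lee_fin sumr_ge0.
- by rewrite /K lerDr.
- exact: ltW.
Qed.

End doob_lipschitz.

(** * Continuous functions of row vectors *)

Section row_vectors.
Context (R : realType) (t : nat).
Implicit Types x y : 'rV[R]_t.

Lemma row_norm_lt x (e : R) : 0 < e -> (forall i, `|x 0 i| < e) -> `|x| < e.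
Proof.
move=> e0 xe; have [x0|x0] := eqVneq (mx_norm x) 0; first by rewrite [ltLHS]x0.
have [[i j] /= E] := mx_norm_neq0 x0.
by rewrite [ltLHS]E (ord1 i).
Qed.

(** The norm is the maximum of the absolute values of the entries, attained once it is nonzero; c >
    0 also excludes rows of length 0. *)
Lemma row_norm_le_exists x (c : R) : 0 < c -> c <= `|x| -> exists i, c <= `|x 0 i|.
Proof.
move=> c0 cx; have x0 : mx_norm x != 0 by rewrite gt_eqF// (lt_le_trans c0).
have [[i j] /= E] := mx_norm_neq0 x0.
by exists j; rewrite -(ord1 i) -E.
Qed.

Let rational_box (q : 'rV[rat]_t) n : set 'rV[R]_t :=
  [set y | forall i, `|ratr (q 0 i) - y 0 i| < n.+1%:R^-1].

(** An open set is the union of the countably many boxes of rational centre and radius 1/(n+1) that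
    it contains; the preimage of a box is a finite intersection of conditions on single
    coordinates. *)
Lemma open_row_preimage d (T : measurableType d) (f : nat -> T -> R) (O : set 'rV[R]_t) :
  (forall i, (i < t)%N -> measurable_fun setT (f i)) -> open O ->
  measurable [set w | O (\row_(i < t) f i w)].
Proof.
move=> mf oO; pose I := ('rV[rat]_t * nat)%type.
pose F (z : I) := if `[< rational_box z.1 z.2 `<=` O >] then
  [set w | rational_box z.1 z.2 (\row_(i < t) f i w)] else set0.
have -> : [set w | O (\row_(i < t) f i w)] = \bigcup_z F z.
  apply/seteqP; split => [w /= Ow|w [[q n] _]]; last first.
    by rewrite /F /=; case: asboolP => // qO /= /qO.
  set x := \row_(i < t) f i w in Ow *.
  have /nbhs_ballP[e /= e0 eO] : nbhs x O by exact: open_nbhs_nbhs.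
  (* With radius below e/2, a box whose centre lies within 1/(n+1) of x in each coordinate stays in
     the ball of radius e. *)
  pose n := Num.truncn (2 / e).
  have n_e : n.+1%:R^-1 < e / 2.
    by rewrite invf_plt ?posrE ?divr_gt0// invf_div truncnS_gt.
  have /choice[q qP] : forall i : 'I_t, exists q : rat, `|ratr q - x 0 i| < n.+1%:R^-1.
    move=> i; have [|q] := @rat_in_itvoo R (x 0 i - n.+1%:R^-1) (x 0 i + n.+1%:R^-1).
      by rewrite ltrD2l gtrN// invr_gt0.
    rewrite in_itv /= => /andP[q1 q2]; exists q.
    by rewrite ltr_distl q1 q2.
  exists (\row_i q i, n) => //; rewrite /F /=.
  case: asboolP => [_ /= i|]; first by rewrite mxE.
  case=> y yq; apply: eO; rewrite mx_norm_ball /ball_ /=.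
  apply: row_norm_lt => // i; rewrite !mxE.
  have := yq i; have := qP i; rewrite !mxE => h1 h2.
  rewrite (_ : _ - _ = (ratr (q i) - y 0 i) - (ratr (q i) - f i w)); last by ring.
  apply: le_lt_trans (ler_normB _ _) _.
  by rewrite [ltRHS](splitr e) ltrD// (lt_trans _ n_e).
apply: countable_bigcupT_measurable; first exact: countableP.
move=> z; rewrite /F; case: ifP => // _.
rewrite (_ : mkset _ = \bigcap_(i in [set: 'I_t])
    [set w | `|ratr (z.1 0 i) - f i w| < z.2.+1%:R^-1]); last first.
  by apply/seteqP; split => w /= H i => [_|]; have := H i; rewrite mxE; apply.
apply: fin_bigcap_measurable => // i _.
apply: measurable_set_lt => //; apply: measurableT_comp => //.
by apply: measurable_funB => //; exact: mf.
Qed.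

Lemma continuous_row_measurable d (T : measurableType d) (f : nat -> T -> R)
    (G : 'rV[R]_t -> R) :
  (forall i, (i < t)%N -> measurable_fun setT (f i)) -> continuous G ->
  measurable_fun setT (fun w => G (\row_(i < t) f i w)).
Proof.
move=> mf /continuousP cG; apply: (measurability _ (RGenOpens.measurableE R)).
move=> _ [_ [a [b ->] <-]]; rewrite setTI.
exact: (@open_row_preimage _ _ f _ mf (cG _ (interval_open _ _))).
Qed.

(* Stands in for a compactness argument: these sets are open, hence measurable
   preimages, and decrease to the empty set when [G] is continuous, so that
   any given law charges them less and less. *)
Definition oscillating (G : 'rV[R]_t -> R) (e : R) (n : nat) : set 'rV[R]_t :=
  [set x | exists y y', [/\ `|x - y| < n.+1%:R^-1, `|x - y'| < n.+1%:R^-1 &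
    e < `|G y - G y'|]].

Lemma open_oscillating G e n : open (oscillating G e n).
Proof.
rewrite openE => x [y [y' [xy xy' yy']]].
pose r := n.+1%:R^-1 - Num.max `|x - y| `|x - y'| : R.
have r0 : 0 < r by rewrite subr_gt0 gt_max xy.
apply/nbhs_ballP; exists r => //= z; rewrite mx_norm_ball /ball_ /= => xz.
have tri v : `|x - v| <= Num.max `|x - y| `|x - y'| -> `|z - v| < n.+1%:R^-1.
  move=> xv; rewrite (_ : z - v = (x - v) - (x - z)); last by rewrite opprB [RHS]addrC subrKA.
  apply: le_lt_trans (ler_normB _ _) _.
  by rewrite -ltrBrDl (lt_le_trans xz)// /r lerB.
by exists y, y'; split => //; apply: tri; rewrite le_max lexx ?orbT.
Qed.

(** At a common point x, both witnesses for large n would lie in a ball where G stays within e/2 of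
    G x. *)
Lemma bigcap_oscillating G e : 0 < e -> continuous G ->
  \bigcap_n oscillating G e n = set0.
Proof.
move=> e0 cG; apply/seteqP; split => // x Hx.
have e2 : 0 < e / 2 by rewrite divr_gt0.
have /nbhs_ballP[r /= r0 rG] : \forall y \near x, `|G x - G y| < e / 2.
  by have /cvgrPdist_lt := cG x; apply.
pose n := Num.truncn r^-1.
have nr : n.+1%:R^-1 < r by rewrite invf_plt ?posrE// truncnS_gt.
have [y [y' [xy xy']]] := Hx n I; apply/negP; rewrite -leNgt.
have h v : `|x - v| < n.+1%:R^-1 -> `|G x - G v| < e / 2.
  by move=> xv; apply: rG; rewrite mx_norm_ball /ball_ /= (lt_trans xv).
rewrite (_ : G y - G y' = (G x - G y') - (G x - G y)); last by ring.
apply: le_trans (ler_normB _ _) _.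
by rewrite [leRHS](splitr e) ltW// ltrD// h.
Qed.

Lemma oscillating_decr G e : {homo oscillating G e : n m / (n <= m)%N >-> m `<=` n}.
Proof.
move=> n m nm x [y [y' [xy xy' yy']]].
have mn : m.+1%:R^-1 <= n.+1%:R^-1 :> R by rewrite lef_pV2 ?posrE// ler_nat.
by exists y, y'; split => //; [exact: lt_le_trans mn|exact: lt_le_trans mn].
Qed.

End row_vectors.

(** * Optimal stopping *)

Section stopping_times.
Context (R : realType) (N : nat) (S : filteredSpace R N).
Implicit Types tau : S -> nat.

Lemma filt_setC t B : (1 <= t <= N)%N -> fs_filt S t B -> fs_filt S t (~` B).
Proof.
by move=> tN FB; have [_ sC _] := fs_filt_sigma_algebra S tN; rewrite -setTD; exact: sC.
Qed.

Lemma filt_setT t : (1 <= t <= N)%N -> fs_filt S t setT.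
Proof. by move=> tN; exact: sigma_algebra_full (fs_filt_sigma_algebra S tN). Qed.

Lemma filt_setU t B C : (1 <= t <= N)%N -> fs_filt S t B -> fs_filt S t C ->
  fs_filt S t (B `|` C).
Proof.
move=> tN FB FC; have sF := fs_filt_sigma_algebra S tN.
rewrite -(measurable_gE sF); apply: measurableU; rewrite measurable_gE//.
Qed.

Lemma filt_le s t B : (1 <= s)%N -> (s <= t <= N)%N -> fs_filt S s B -> fs_filt S t B.
Proof. by move=> s1 stN; exact: fs_filt_nondecreasing. Qed.

Lemma stopping_time_gt tau t : stopping_time tau -> (1 <= t <= N)%N ->
  fs_filt S t [set w | (t < tau w)%N].
Proof.
move=> [_ st] tN; rewrite (_ : [set w | _] = ~` [set w | (tau w <= t)%N]).
  by apply: filt_setC => //; exact: st.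
by apply/seteqP; split => w /=; rewrite ltnNge => /negP.
Qed.

Lemma stopping_time_ge tau t : stopping_time tau -> (1 <= t <= N)%N ->
  fs_filt S t [set w | (t <= tau w)%N].
Proof.
move=> st; case: t => [//|[|t]] tN.
  rewrite (_ : [set w | _] = setT); first exact: filt_setT.
  by apply/seteqP; split => w //= _; have [/(_ w)/andP[]] := st.
apply: (@filt_le t.+1) => //; first by rewrite leqnSn.
by apply: stopping_time_gt => //; exact: ltnW.
Qed.

Lemma stopping_time_eq tau t : stopping_time tau -> (1 <= t <= N)%N ->
  fs_filt S t [set w | tau w = t].
Proof.
move=> st tN; rewrite (_ : [set w | _] =
    ~` ([set w | (t < tau w)%N] `|` ~` [set w | (t <= tau w)%N])).
  apply: filt_setC => //; apply: filt_setU => //; first exact: stopping_time_gt.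
  by apply: filt_setC => //; exact: stopping_time_ge.
apply/seteqP; split => w /=.
  by move=> ->; rewrite leqnn ltnn => -[].
move=> /not_orP[/negP]; rewrite -leqNgt => h1 /contrapT h2.
by apply/eqP; rewrite eqn_leq h1.
Qed.

Context (h : nat -> S -> R) (B : R).
Hypothesis mh : forall t, (1 <= t <= N)%N -> measurable_wrt (fs_filt S t) (h t).
Hypothesis hB : forall t w, (1 <= t <= N)%N -> `|h t w| <= B.

Lemma stopped_measurable tau : (0 < N)%N -> stopping_time tau ->
  measurable_wrt (fs_filt S N) (fun w => h (tau w) w).
Proof.
move=> N0 st; have NN : (1 <= N <= N)%N by rewrite N0 leqnn.
have sN := fs_filt_sigma_algebra S NN.
rewrite (_ : (fun w => _) = (fun w =>
    \sum_(1 <= t < N.+1) \1_[set w | tau w = t] w * h t w)); last first.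
  apply/funext => w; have [/(_ w) tw _] := st.
  rewrite (big_rem (tau w)) ?mem_index_iota//= indicE mem_set// mul1r.
  rewrite big_seq big1 ?addr0// => t; rewrite mem_rem_uniq ?iota_uniq//.
  rewrite inE => /andP[/= tt _]; rewrite indicE memNset ?mul0r//= => E.
  by rewrite E eqxx in tt.
apply: (@measurable_nat_sum _ (g_sigma_algebraType (fs_filt S N))) => t tN.
have tNN : (t <= N <= N)%N by case/andP: tN => _; rewrite ltnS leqnn => ->.
apply: (@measurable_funM _ (g_sigma_algebraType (fs_filt S N))).
  apply: (@measurable_indic _ (g_sigma_algebraType (fs_filt S N))).
  rewrite measurable_gE//; apply: filt_le tNN _; first by case/andP: tN.
  exact: stopping_time_eq.
apply: (@measurable_wrt_sub _ R (fs_filt S t)) => //.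
- exact: fs_filt_sigma_algebra.
- by apply: fs_filt_nondecreasing => //; case/andP: tN.
- exact: mh.
Qed.

Lemma stopped_intg tau : (0 < N)%N -> stopping_time tau ->
  intg (fs_prob S) (fun w => h (tau w) w).
Proof.
move=> N0 st; have NN : (1 <= N <= N)%N by rewrite N0 leqnn.
apply: (@intg_bounded _ _ _ _ _ B).
  apply: (measurable_wrt_fun (fs_filt_sigma_algebra S NN)).
    exact: fs_filt_measurable.
  exact: stopped_measurable.
by move=> w; apply: hB; have [] := st.
Qed.

End stopping_times.

(** * Stopping times of X used as randomized stopping rules for Y *)

Section optimal_stopping.
Context (R : realType) (N : nat) (N_gt0 : (0 < N)%N) (X Y : filteredSpace R N).
Context d (Omega : measurableType d) (Q : probability Omega R).
Context (f : Omega -> X) (g : Omega -> Y).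
Hypotheses (mf : measurable_fun setT f) (mg : measurable_fun setT g).
Hypothesis gP : forall B, measurable B -> pushforward Q g B = fs_prob Y B.
Hypothesis caus : forall t, (1 <= t <= N)%N ->
  cond_independent Q (preimage_set_system setT g (fs_filt Y N))
    (preimage_set_system setT f (fs_filt X t))
    (preimage_set_system setT g (fs_filt Y t)).
Context (h : nat -> Y -> R) (B : R).
Hypothesis mh : forall t, (1 <= t <= N)%N -> measurable_wrt (fs_filt Y t) (h t).
Hypothesis hB : forall t w, (1 <= t <= N)%N -> `|h t w| <= B.

Let NN : (1 <= N <= N)%N. Proof. by rewrite N_gt0 leqnn. Qed.

Let mpre (a : set X) t : (1 <= t <= N)%N -> fs_filt X t a -> measurable (f @^-1` a).
Proof.
by move=> tN Fa; rewrite -[_ @^-1` _]setTI; apply: mf => //; exact: fs_filt_measurable Fa.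
Qed.

Lemma stopped_foreign_intg (tau : X -> nat) : stopping_time tau ->
  intg Q (fun w => h (tau (f w)) (g w)).
Proof.
move=> st; rewrite (_ : (fun w => _) = (fun w =>
    \sum_(1 <= t < N.+1) \1_(f @^-1` [set x | tau x = t]) w * h t (g w))); last first.
  apply/funext => w; have [/(_ (f w)) tw _] := st.
  rewrite (big_rem (tau (f w))) ?mem_index_iota//= indicE mem_set// mul1r.
  rewrite big_seq big1 ?addr0// => t; rewrite mem_rem_uniq ?iota_uniq//.
  rewrite inE => /andP[/= tt _]; rewrite indicE memNset ?mul0r//= => E.
  by rewrite E eqxx in tt.
apply: (@intg_bounded _ _ _ _ _ (\sum_(1 <= t < N.+1) B)).
  apply: measurable_nat_sum => t tN; apply: measurable_funM.
    by apply: measurable_indic; apply: (mpre tN); exact: stopping_time_eq.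
  apply: measurableT_comp => //.
  apply: (measurable_wrt_fun (fs_filt_sigma_algebra Y tN)); last exact: mh.
  exact: fs_filt_measurable.
move=> w; apply: le_trans (ler_norm_sum _ _ _) _.
rewrite big_nat_cond [leRHS]big_nat_cond; apply: ler_sum => t /andP[tN _].
rewrite normrM -[leRHS]mul1r ler_pM//; first exact: norm_indic_le1.
exact: hB.
Qed.

(* [sigma] stops at time [N - t] when the payoff [h] is at least the conditional
   expectation [C] of continuing with the rule obtained for later times. *)
Lemma foreign_stopping_from t : (t < N)%N -> exists2 sigma : Y -> nat,
  stopping_time sigma /\ (forall y, (N - t <= sigma y)%N) &
  forall tau : X -> nat, stopping_time tau ->
    \int[Q]_w (\1_(f @^-1` [set x | (N - t <= tau x)%N]) w * h (tau (f w)) (g w)) <=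
    \int[Q]_w (\1_(f @^-1` [set x | (N - t <= tau x)%N]) w * h (sigma (g w)) (g w)).
Proof.
elim: t => [_|t IH tN].
  (* At the horizon one can only stop at N, and tau >= N forces tau = N. *)
  exists (fun=> N).
    split; last by move=> y; rewrite subn0.
    split; first by move=> w; rewrite NN.
    move=> t tN; have [Nt|Nt] := leqP N t.
      rewrite (_ : mkset _ = setT); first exact: filt_setT.
      by apply/seteqP; split.
    rewrite (_ : mkset _ = set0); last by apply/seteqP; split.
    by have [] := fs_filt_sigma_algebra Y tN.
  move=> tau st; rewrite le_eqVlt; apply/orP; left; apply/eqP.
  apply: eq_Rintegral => w _; rewrite subn0 indicE.
  have [|_] := boolP (w \in _); last by rewrite !mul0r.
  rewrite inE /= => Nt; congr (_ * h _ _).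
  by apply/eqP; rewrite eqn_leq Nt andbT; have [/(_ (f w))/andP[]] := st.
have [sigma' [st' ge'] opt'] := IH (ltnW tN).
(* [s] is the new decision time; the induction hypothesis concerns the event {tau >= N - t} = {tau >
   s}. *)
set s := (N - t.+1)%N.
have sE : (N - t)%N = s.+1 by rewrite /s subnSK// ltnW.
have s1 : (1 <= s)%N by rewrite subn_gt0.
have sN : (1 <= s <= N)%N by rewrite s1 leq_subr.
pose V y := h (sigma' y) y.
have IV : intg (fs_prob Y) V by exact: (stopped_intg mh hB).
have mV : measurable_wrt (fs_filt Y N) V by exact: stopped_measurable.
have sY := fs_filt_sigma_algebra Y sN; have mY := @fs_filt_measurable _ _ Y _ sN.
have [C cC] := cond_exp_exists sY mY IV.
have [mC IC _] := (is_cond_expP mY _ IV).1 cC.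
pose E : set Y := [set y | C y <= h s y].
have FE : fs_filt Y s E by apply: measurable_wrt_set_le => //; exact: mh.
pose sigma y := if C y <= h s y then s else sigma' y.
have sts : stopping_time sigma.
  split.
    move=> y; rewrite /sigma; case: ifP => // _.
    by have [] := st'.
  move=> r rN; have [sr|rs] := leqP s r; last first.
    rewrite (_ : [set w | _] = set0); first by have [] := fs_filt_sigma_algebra Y rN.
    apply/seteqP; split => // y /=; rewrite /sigma leqNgt => /negP; apply.
    by case: ifP => // _; apply: leq_trans (ge' y); rewrite sE ltnW.
  rewrite (_ : [set w | _] = E `|` [set y | (sigma' y <= r)%N]); last first.
    apply/seteqP; split => y /=; rewrite /sigma /E /=.
      by case: ifP => _; [left|right].
    by case: ifP => // _ [].
  apply: filt_setU => //; last by have [_] := st'; apply.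
  by apply: filt_le FE => //; rewrite sr; case/andP: rN.
exists sigma.
  split => // y; rewrite /sigma; case: ifP => // _.
  by apply: leq_trans (ge' y); rewrite sE.
move=> tau st.
set a := [set x | (s <= tau x)%N]; set a' := [set x | (s < tau x)%N].
set a0 := [set x | tau x = s].
have Fa : fs_filt X s a by exact: stopping_time_ge.
have Fa' : fs_filt X s a' by exact: stopping_time_gt.
have Fa0 : fs_filt X s a0 by exact: stopping_time_eq.
have ma := mpre sN Fa; have ma' := mpre sN Fa'; have ma0 := mpre sN Fa0.
have Ih : intg Q (fun w => h s (g w)).
  apply: (@intg_bounded _ _ _ _ _ B); last by move=> w; exact: hB.
  apply: measurableT_comp => //.
  by apply: (measurable_wrt_fun sY) => //; exact: mh.
have IVg := intg_image mg gP IV; have ICg := intg_image mg gP IC.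
have Itau := stopped_foreign_intg st.
have mEC : measurable (g @^-1` (~` E)).
  by rewrite -[_ @^-1` _]setTI; apply: mg => //; apply: mY; exact: filt_setC.
have mE : measurable (g @^-1` E).
  by rewrite -[_ @^-1` _]setTI; apply: mg => //; exact: mY.
(* Causality enters here: the later payoff V may be replaced by C on {tau > s}, and on {tau >= s}
   intersected with the complement of E. *)
have c1 := causal_integral mf mg gP caus sN IV mV cC Fa' (filt_setT Y sN).
have c2 := causal_integral mf mg gP caus sN IV mV cC Fa (filt_setC sN FE).
rewrite [leLHS](_ : _ = \int[Q]_w (\1_(f @^-1` a0) w * h s (g w)) +
    \int[Q]_w (\1_(f @^-1` a') w * h (tau (f w)) (g w))); last first.
  rewrite -RintegralD//; [|exact: intg_indicM|exact: intg_indicM].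
  apply: eq_Rintegral => w _; rewrite !indicE.
  have [h1|h1|h1] := ltngtP s (tau (f w)).
  - rewrite mem_set /a /=; last exact: ltnW.
    rewrite memNset /a0 /=; last by move=> h2; rewrite h2 ltnn in h1.
    by rewrite mem_set// mul0r add0r.
  - rewrite memNset /a /=; last by rewrite leqNgt h1.
    rewrite memNset /a0 /=; last by move=> h2; rewrite h2 ltnn in h1.
    rewrite memNset /a' /=; last by rewrite ltnNge ltnW.
    by rewrite !mul0r addr0.
  - rewrite mem_set /a /=; last by rewrite h1.
    rewrite mem_set /a0 /=; last by rewrite h1.
    rewrite memNset /a' /=; last by rewrite h1 ltnn.
    by rewrite mul0r addr0 -h1.
rewrite [leRHS](_ : _ = \int[Q]_w (\1_(f @^-1` a) w * (\1_(g @^-1` E) w * h s (g w))) +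
    \int[Q]_w (\1_(f @^-1` a) w * (\1_(g @^-1` (~` E)) w * V (g w)))); last first.
  rewrite -RintegralD//; [|exact/intg_indicM/intg_indicM|exact/intg_indicM/intg_indicM].
  apply: eq_Rintegral => w _; rewrite -mulrDr; congr (_ * _).
  rewrite /V /sigma !indicE; case: ifP => [Ew|/negP Ew].
    by rewrite mem_set// memNset ?mul1r ?mul0r ?addr0//=; apply.
  by rewrite memNset// mem_set// mul1r mul0r add0r.
have I1 := intg_indicM ma (intg_indicM mE Ih).
have I2 := intg_indicM ma (intg_indicM mEC ICg).
rewrite c2 -[leRHS](RintegralD measurableT I1 I2).
have unit1 (k : Omega -> R) :
    \int[Q]_w (\1_(f @^-1` a') w * (\1_(g @^-1` setT) w * k w)) =
    \int[Q]_w (\1_(f @^-1` a') w * k w).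
  by apply: eq_Rintegral => w _; rewrite preimage_setT indicT mul1r.
rewrite !unit1 in c1.
apply: (@le_trans _ _ (\int[Q]_w (\1_(f @^-1` a0) w * h s (g w)) +
  \int[Q]_w (\1_(f @^-1` a') w * C (g w)))).
  by rewrite lerD2l -c1 -/a'; have := opt' _ st; rewrite sE.
rewrite -RintegralD//; [|exact: intg_indicM|exact: intg_indicM].
apply: le_Rintegral => //.
- by apply: intgD; exact: intg_indicM.
- by apply: intgD; exact/intg_indicM/intg_indicM.
move=> w _; rewrite !indicE -mulrDr.
(* [sigma] collects the maximum of h_s and C, which dominates h_s on {tau = s} and C on {tau >
   s}. *)
have -> : (w \in g @^-1` E)%:R * h s (g w) + (w \in g @^-1` (~` E))%:R * C (g w) =
    Num.max (h s (g w)) (C (g w)).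
  have [Ew|Ew] := leP (C (g w)) (h s (g w)).
    by rewrite mem_set// memNset ?mul1r ?mul0r ?addr0//=; apply.
  rewrite memNset/=; last by rewrite /E /= leNgt Ew.
  by rewrite mem_set/= ?mul1r ?mul0r ?add0r// /E /= leNgt Ew.
have [h1|h1|h1] := ltngtP s (tau (f w)).
- rewrite memNset /a0 /=; last by move=> h2; rewrite h2 ltnn in h1.
  rewrite mem_set// mem_set /a /=; last exact: ltnW.
  by rewrite mul0r add0r !mul1r le_max lexx orbT.
- rewrite memNset /a0 /=; last by move=> h2; rewrite h2 ltnn in h1.
  rewrite memNset /a' /=; last by rewrite ltnNge ltnW.
  rewrite memNset /a /=; last by rewrite leqNgt h1.
  by rewrite !mul0r addr0.
- rewrite mem_set /a0 /=; last by rewrite h1.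
  rewrite memNset /a' /=; last by rewrite h1 ltnn.
  rewrite mem_set /a /=; last by rewrite h1.
  by rewrite mul0r addr0 !mul1r le_max lexx.
Qed.

(** The backward induction is run down to time 1, where {tau >= 1} is the whole space. The rule
    [sigma] is fixed before tau, so it beats all transported stopping times at once. *)
Lemma foreign_stopping_le : exists2 sigma : Y -> nat, stopping_time sigma &
  forall tau : X -> nat, stopping_time tau ->
  \int[Q]_w h (tau (f w)) (g w) <= \int[fs_prob Y]_y h (sigma y) y.
Proof.
have [|sigma [st _] opt] := @foreign_stopping_from N.-1; first by rewrite ltn_predL.
exists sigma => // tau stau; have := opt _ stau.
have E (k : Omega -> R) :
   \int[Q]_w (\1_(f @^-1` [set x | (N - N.-1 <= tau x)%N]) w * k w) = \int[Q]_w k w.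
  apply: eq_Rintegral => w _; rewrite indicE mem_set ?mul1r//=.
  rewrite -subn1 subKn//.
  by have [/(_ (f w))/andP[]] := stau.
rewrite !E => /le_trans; apply.
by rewrite -(Rintegral_image mg gP (stopped_intg mh hB N_gt0 st)).
Qed.

End optimal_stopping.

Lemma Rintegral_cst_probability d (T : measurableType d) (R : realType)
  (P : probability T R) (r : R) : \int[P]_w r = r.
Proof.
rewrite (Rintegral_cst P (@measurableT _ T)).
rewrite -[RHS]mulr1; congr (_ * _); rewrite -[RHS]/(fine 1%E); congr fine.
exact: probability_setT.
Qed.

Section stopping_value_comparison.
Context (R : realType) (N : nat) (N_gt0 : (0 < N)%N).
Context (G : forall t, 'rV[R]_t -> R) (B : R).
Arguments G : clear implicits.
Hypothesis cG : forall t, (1 <= t <= N)%N -> continuous (G t).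
Hypothesis GB : forall t (x : 'rV[R]_t), (1 <= t <= N)%N -> `|G t x| <= B.

Let payoff (X : filteredProcess R N R) t (w : X) : R := G t (path_upto t w).

Lemma payoff_measurable (X : filteredProcess R N R) t : (1 <= t <= N)%N ->
  measurable_wrt (fs_filt X t) (payoff t).
Proof.
move=> tN; apply: (@continuous_row_measurable _ _ _ (g_sigma_algebraType (fs_filt X t))
  (fun i => fp_val X i.+1)); last exact: cG.
move=> i it; have iN : (1 <= i.+1 <= N)%N.
  by case/andP: tN => _; exact: leq_trans.
have itN : (i.+1 <= t <= N)%N by rewrite it; case/andP: tN.
apply: (@measurable_wrt_sub _ R (fs_filt X i.+1)); last exact: fp_adapted.
- exact: fs_filt_sigma_algebra.
- exact: fs_filt_sigma_algebra.
- exact: fs_filt_nondecreasing.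
Qed.

Let payoff_bounded (X : filteredProcess R N R) t (w : X) : (1 <= t <= N)%N ->
  `|payoff t w| <= B.
Proof. exact: GB. Qed.

Lemma stopped_payoff_expectation (X : filteredProcess R N R) (tau : X -> nat) :
  stopping_time tau ->
  'E_(fs_prob X)[fun w => payoff (tau w) w]%E =
  (\int[fs_prob X]_w (payoff (tau w) w))%:E.
Proof.
move=> st; rewrite unlock /Rintegral fineK//.
apply: integrable_fin_num => //.
exact: (stopped_intg (@payoff_measurable X) (@payoff_bounded X)).
Qed.

(** Reduces the difference of two values to real arithmetic; the constant time N gives the lower
    bound, B the upper one. *)
Lemma stopping_value_fin_num (X : filteredProcess R N R) :
  stopping_value G X \is a fin_num.
Proof.
have stN : stopping_time (fun _ : X => N).
  split; first by move=> w; rewrite N_gt0 leqnn.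
  move=> t tN; have [Nt|Nt] := leqP N t.
    rewrite (_ : mkset _ = setT); first exact: filt_setT.
    by apply/seteqP; split.
  rewrite (_ : mkset _ = set0); last by apply/seteqP; split.
  by have [] := fs_filt_sigma_algebra X tN.
rewrite fin_numElt; apply/andP; split.
  apply: lt_le_trans (ereal_sup_ubound _); last by exists (fun _ => N).
  by rewrite stopped_payoff_expectation// ltNyr.
apply: le_lt_trans (ltry B); apply: ge_ereal_sup => _ [tau st <-].
rewrite stopped_payoff_expectation// lee_fin.
have I := stopped_intg (@payoff_measurable X) (@payoff_bounded X) N_gt0 st.
rewrite [leRHS](_ : B = \int[fs_prob X]_w B); last first.
  by rewrite Rintegral_cst_probability.
apply: le_Rintegral => //; first exact: finite_measure_integrable_cst.
by move=> w _; apply: le_trans (ler_norm _) _; apply: payoff_bounded; case: st.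
Qed.

(** For a given tau, evaluating the payoff along g instead of f costs at most D, and the resulting
    value on Y is dominated by [foreign_stopping_le]. The bound is one-sided, to be used with both
    orders of the projections. *)
Lemma stopping_value_le (X Y : filteredProcess R N R) d (Omega : measurableType d)
    (Q : probability Omega R) (f : Omega -> X) (g : Omega -> Y) (D : Omega -> R) :
  measurable_fun setT f -> measurable_fun setT g ->
  (forall A, measurable A -> pushforward Q f A = fs_prob X A) ->
  (forall A, measurable A -> pushforward Q g A = fs_prob Y A) ->
  (forall t, (1 <= t <= N)%N ->
    cond_independent Q (preimage_set_system setT g (fs_filt Y N))
      (preimage_set_system setT f (fs_filt X t))
      (preimage_set_system setT g (fs_filt Y t))) ->
  intg Q D ->
  (forall t w, (1 <= t <= N)%N -> payoff t (f w) - payoff t (g w) <= D w) ->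
  (stopping_value G X <= stopping_value G Y + (\int[Q]_w D w)%:E)%E.
Proof.
move=> mf mg fP gP caus ID hD.
have mY := @payoff_measurable Y; have bY := @payoff_bounded Y.
apply: ge_ereal_sup => _ [tau st <-]; rewrite stopped_payoff_expectation//.
have [sigma sts opt] := foreign_stopping_le N_gt0 mf mg gP caus mY bY.
have IX := stopped_intg (@payoff_measurable X) (@payoff_bounded X) N_gt0 st.
have IY := stopped_foreign_intg Q mf mg mY bY st.
apply: (@le_trans _ _ ((\int[fs_prob Y]_y (payoff (sigma y) y))%:E + (\int[Q]_w D w)%:E)%E).
  rewrite -(Rintegral_image mf fP IX) -EFinD lee_fin.
  apply: (@le_trans _ _ (\int[Q]_w (payoff (tau (f w)) (g w) + D w))).
    apply: le_Rintegral => //; [exact: (intg_image mf fP IX)|exact: intgD|].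
    by move=> w _; rewrite -lerBlDl; apply: hD; case: st.
  by rewrite RintegralD// lerD2r; exact: opt.
apply: leeD => //; apply: ereal_sup_ubound; exists sigma => //.
exact: stopped_payoff_expectation.
Qed.

Lemma stopping_value_dist (X Y : filteredProcess R N R)
    (pi : probability (X * Y)%type R) (D : X * Y -> R) :
  bicausal_couplings pi -> intg pi D ->
  (forall t w, (1 <= t <= N)%N ->
    `|G t (path_upto t w.1) - G t (path_upto t w.2)| <= D w) ->
  (`|stopping_value G X - stopping_value G Y| <= (\int[pi]_w D w)%:E)%E.
Proof.
move=> bpi ID hD; have [_ cau anti] := bpi.
have m1 := @measurable_fst _ _ X Y; have m2 := @measurable_snd _ _ X Y.
have XY : (stopping_value G X <= stopping_value G Y + (\int[pi]_w D w)%:E)%E.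
  apply: (stopping_value_le m1 m2 (coupling_fst bpi) (coupling_snd bpi) anti ID).
  by move=> t w tN; exact: le_trans (ler_norm _) (hD t w tN).
have YX : (stopping_value G Y <= stopping_value G X + (\int[pi]_w D w)%:E)%E.
  apply: (stopping_value_le m2 m1 (coupling_snd bpi) (coupling_fst bpi) cau ID).
  by move=> t w tN; apply: le_trans (ler_norm _) _; rewrite distrC; exact: hD.
have fX := stopping_value_fin_num X; have fY := stopping_value_fin_num Y.
rewrite -(fineK fX) -(fineK fY) -!EFinD !lee_fin in XY YX *.
by rewrite ler_distl; apply/andP; split; lra.
Qed.

End stopping_value_comparison.

(** * Regularity of the optimal stopping value *)

Section stopping_value_continuity.
Context (R : realType) (N : nat) (p : R) (N_gt0 : (0 < N)%N) (p_ge1 : 1 <= p).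
Context (G : forall t, 'rV[R]_t -> R) (B : R).
Arguments G : clear implicits.
Hypothesis GB : forall t (x : 'rV[R]_t), (1 <= t <= N)%N -> `|G t x| <= B.

Let p_gt0 : 0 < p. Proof. exact: lt_le_trans p_ge1. Qed.

Let Sp (X Y : filteredProcess R N R) (w : X * Y) :=
  \sum_(1 <= s < N.+1) `|fp_val X s w.1 - fp_val Y s w.2| `^ p.

Let Sp_ge (X Y : filteredProcess R N R) (w : X * Y) t (i : 'I_t) : (1 <= t <= N)%N ->
  `|fp_val X i.+1 w.1 - fp_val Y i.+1 w.2| `^ p <= Sp w.
Proof.
move=> tN; rewrite /Sp (big_rem i.+1)/=.
  by rewrite lerDl sumr_ge0// => s _; exact: powR_ge0.
by rewrite mem_index_iota /= ltnS (leq_trans (ltn_ord i))//; case/andP: tN.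
Qed.

Let Sp0 (X Y : filteredProcess R N R) (w : X * Y) : 0 <= Sp w.
Proof. by rewrite sumr_ge0// => s _; exact: powR_ge0. Qed.

Let intg_Sp (X Y : filteredProcess R N R) (pi : probability (X * Y)%type R) (e : R) :
  (transport_cost (fun x y : R => (`|x - y| `^ p)%R) pi < e%:E)%E ->
  intg pi (@Sp X Y) /\ \int[pi]_w (@Sp X Y w) < e.
Proof.
move=> Hlt; have mS : measurable_fun setT (@Sp X Y).
  apply: measurable_nat_sum => s sN; apply: measurable_norm_powR.
  apply: measurable_funB.
    by apply: (measurableT_comp _ measurable_fst); exact: fp_val_measurable.
  by apply: (measurableT_comp _ measurable_snd); exact: fp_val_measurable.
have IS : intg pi (@Sp X Y).
  apply/integrableP; split; first exact/measurable_EFinP.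
  apply: lt_trans (ltry e); apply: le_lt_trans Hlt.
  rewrite /transport_cost le_eqVlt; apply/orP; left; apply/eqP.
  by apply: eq_integral => w _; rewrite /= ger0_norm// sumr_ge0.
split => //; rewrite -lte_fin; apply: le_lt_trans Hlt.
by rewrite /Rintegral fineK//; exact: (integrable_fin_num measurableT IS).
Qed.

(** If the p-th moment of a is at most del^p, integration gives a mean of at most 2 del. For a >
    del, the factor (a / del)^(p-1) is at least 1. *)
Let powR_split (a del : R) : 0 < del -> 0 <= a -> a <= del + del `^ (1 - p) * a `^ p.
Proof.
move=> del0 a0; have [ad|da] := leP a del.
  by rewrite (le_trans ad)// lerDl mulr_ge0 ?powR_ge0.
apply: (@le_trans _ _ (del `^ (1 - p) * a `^ p)); last by rewrite lerDr ltW.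
rewrite -opprB powRN mulrC ler_pdivlMr ?powR_gt0//.
rewrite -(mulr_powRB1 a0 p_gt0) ler_wpM2l// ge0_ler_powR ?nnegrE ?subr_ge0//; exact: ltW.
Qed.

Let AW_ge0 (X Y : filteredProcess R N R) : (0 <= AW p X Y)%E.
Proof. exact: AW_cost_ge0. Qed.

Let cost0 (x y : R) : 0 <= `|x - y| `^ p. Proof. exact: powR_ge0. Qed.

Lemma stopping_value_lipschitz :
  (forall t, (1 <= t <= N)%N -> lipschitz (G t)) ->
  AW_lipschitz p (stopping_value (N := N) G).
Proof.
move=> lipG.
have /choice[K KP] : forall t, exists K : R, 0 <= K /\ ((1 <= t <= N)%N ->
    forall x y, `|G t x - G t y| <= K * `|x - y|).
  move=> t; case: (boolP (1 <= t <= N)%N) => [tN|_]; last by exists 0.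
  have [M [_ HM]] := lipG _ tN; exists (`|M| + 1); split; first by rewrite addr_ge0.
  move=> _ x y; have := HM (`|M| + 1); rewrite ltr_pwDr// ?ler_norm//.
  by move=> /(_ isT (x, y)); apply.
have cG t : (1 <= t <= N)%N -> continuous (G t).
  move=> tN x A /nbhs_ballP[e /= e0 eA]; have [K0 HK] := KP t.
  have K1 : 0 < K t + 1 by rewrite ltr_wpDl.
  apply/nbhs_ballP; exists (e / (K t + 1)); first by rewrite /= divr_gt0.
  move=> y; rewrite mx_norm_ball /ball_ /= => xy; apply: eA; rewrite /ball /=.
  apply: le_lt_trans (HK tN _ _) _; apply: (@le_lt_trans _ _ ((K t + 1) * `|x - y|)).
    by rewrite ler_wpM2r// lerDl.
  by rewrite mulrC -ltr_pdivlMr.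
(* A common Lipschitz constant: the sum stands for a maximum over t, and the 1 makes it positive. *)
pose K1 := 1 + \sum_(1 <= t < N.+1) K t.
have K1_gt0 : 0 < K1 by rewrite ltr_pwDl// sumr_ge0// => t _; have [] := KP t.
have KK1 t : (1 <= t <= N)%N -> K t <= K1.
  move=> tN; rewrite /K1 (big_rem t) ?mem_index_iota//= addrCA lerDl addr_ge0//.
  by apply: sumr_ge0 => s _; have [] := KP s.
exists (K1 * 2); first by rewrite mulr_ge0// ltW.
move=> X Y FX FY; apply: le_mule_of_lt => //; first by rewrite mulr_gt0.
move=> del Hdel; have [pi bpi Hpi] := AW_cost_lt p_ge1 cost0 Hdel.
have del0 : 0 < del by rewrite -lte_fin (le_lt_trans _ Hdel).
have [IS ltS] := intg_Sp Hpi.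
pose D w := K1 * (del + del `^ (1 - p) * @Sp X Y w).
have IS' : intg pi (fun w => del + del `^ (1 - p) * Sp w).
  by apply: intgD; [exact: finite_measure_integrable_cst|exact: intgZ].
apply: (@le_trans _ _ (\int[pi]_w D w)%:E).
  apply: (stopping_value_dist N_gt0 cG GB bpi); first exact: intgZ.
  move=> t w tN; have [K0 HK] := KP t.
  apply: le_trans (HK tN _ _) _.
  have nn : 0 <= del + del `^ (1 - p) * Sp w.
    by rewrite addr_ge0 ?(ltW del0)// mulr_ge0 ?powR_ge0.
  apply: (@le_trans _ _ (K t * (del + del `^ (1 - p) * Sp w))); last first.
    by rewrite ler_wpM2r// KK1.
  (* By contradiction, because the norm is attained at a coordinate only when it is positive;
     [powR_split] then bounds that coordinate. *)
  rewrite ler_wpM2l//; rewrite leNgt; apply/negP => Hlt.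
  have del_lt : del < `|path_upto t w.1 - path_upto t w.2|.
    by apply: le_lt_trans Hlt; rewrite lerDl mulr_ge0 ?powR_ge0.
  have [i Hi] := row_norm_le_exists (lt_trans del0 del_lt) (lexx _).
  move: Hlt; rewrite ltNge => /negP; apply; apply: le_trans Hi _; rewrite !mxE.
  apply: le_trans (powR_split del0 (normr_ge0 _)) _.
  by rewrite lerD2l ler_wpM2l ?powR_ge0//; exact: Sp_ge.
rewrite lee_fin RintegralZl// RintegralD//; last 2 first.
- exact: finite_measure_integrable_cst.
- exact: intgZ.
rewrite Rintegral_cst_probability RintegralZl// -mulrA ler_wpM2l ?(ltW K1_gt0)//.
rewrite mulr_natl mulr2n lerD2l.
apply: (@le_trans _ _ (del `^ (1 - p) * del `^ p)).
  by rewrite ler_wpM2l ?powR_ge0// ltW.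
rewrite -powRD; first by rewrite subrK powRr1// ltW.
by rewrite (gt_eqF del0) implybT.
Qed.

(** The paths near which G oscillates by more than e0 at scale 1/(n+1) form events decreasing to the
    empty set, so one has probability at most e1. Both r and W depend on X alone while y is
    arbitrary, which serves for every Y. *)
Lemma uniformly_continuous_off_small_set (X : filteredProcess R N R) t (e0 e1 : R) :
  (1 <= t <= N)%N -> continuous (G t) -> 0 < e0 -> 0 < e1 ->
  exists r (W : set X), [/\ 0 < r, measurable W, (fs_prob X W <= e1%:E)%E &
    forall w y, ~ W w -> `|path_upto t w - y| < r ->
      `|G t (path_upto t w) - G t y| <= e0].
Proof.
move=> tN cG e00 e10.
pose W n := [set w : X | oscillating (G t) e0 n (path_upto t w)].
have mW n : measurable (W n).
  apply: (@open_row_preimage _ _ _ _ (fun i => fp_val X i.+1)).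
    move=> i it; apply: fp_val_measurable.
    by case/andP: tN => _; exact: leq_trans.
  exact: open_oscillating.
have W0 : \bigcap_n W n = set0.
  apply/seteqP; split => // w Hw.
  have : (\bigcap_n oscillating (G t) e0 n) (path_upto t w) by move=> n _; exact: Hw.
  by rewrite bigcap_oscillating.
have : (fs_prob X \o W) n @[n --> \oo] --> fs_prob X (\bigcap_n W n).
  apply: nonincreasing_cvg_mu => //.
  - by rewrite (le_lt_trans (probability_le1 _ _)) ?ltry.
  - by rewrite W0.
  - move=> n m nm; apply/subsetPset => w; exact: oscillating_decr.
rewrite W0 measure0 => cvgW.
have [n Hn] : exists n, (fs_prob X (W n) < e1%:E)%E.
  apply: contrapT => /forallNP H.
  have : (e1%:E <= limn (fs_prob X \o W))%E.
    apply: lime_ge; first by apply/cvg_ex; exists 0%E.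
    by apply: nearW => n; rewrite leNgt; apply/negP; exact: H.
  by rewrite (cvg_lim _ cvgW)// lee_fin leNgt e10.
exists n.+1%:R^-1, (W n); split => //; first exact: ltW.
move=> w y Ww wy; rewrite leNgt; apply/negP => Hlt; apply: Ww.
(* The path itself, at distance 0, is one of the two witnesses of oscillation. *)
by exists (path_upto t w), y; split => //; rewrite subrr normr0.
Qed.

Lemma stopping_value_continuous :
  (forall t, (1 <= t <= N)%N -> continuous (G t)) ->
  AW_continuous p (stopping_value (N := N) G).
Proof.
move=> cG X FX e e_gt0.
have B0 : 0 <= B.
  have NN : (1 <= N <= N)%N by rewrite N_gt0 leqnn.
  exact: le_trans (normr_ge0 _) (GB 0 NN).
have N0 : 0 < N%:R :> R by rewrite ltr0n.
(* Error budget: e/4 for the modulus of continuity, at most e/4 for the N exceptional sets, each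
   weighing at most 2 B e1, and at most e/4 for paths moved far. Writing B + 1 avoids a division by
   zero. *)
pose e0 := e / 4; pose e1 := e / (8 * N%:R * (B + 1)).
have e00 : 0 < e0 by rewrite divr_gt0.
have e10 : 0 < e1 by rewrite divr_gt0// !mulr_gt0// ltr_wpDl.
have /choice[z zP] : forall t, exists z : R * set X,
    [/\ 0 < z.1, measurable z.2, (fs_prob X z.2 <= e1%:E)%E &
    (1 <= t <= N)%N -> forall w y, ~ z.2 w -> `|path_upto t w - y| < z.1 ->
      `|G t (path_upto t w) - G t y| <= e0].
  move=> t; case: (boolP (1 <= t <= N)%N) => [tN|_]; last first.
    by exists (1, set0); split => //=; rewrite measure0 lee_fin ltW.
  have [r [W [r0 mW PW HW]]] := uniformly_continuous_off_small_set X tN (cG t tN) e00 e10.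
  by exists (r, W).
(* Markov's inequality for paths moved far: there the cost divided by (z t).1^p is at least 1, and
   payoffs differ by at most 2 B. *)
pose c := \sum_(1 <= t < N.+1) 2 * B * ((z t).1 `^ p)^-1.
have cterm t : 0 <= 2 * B * ((z t).1 `^ p)^-1.
  by rewrite !mulr_ge0// invr_ge0 powR_ge0.
have c0 : 0 <= c by rewrite sumr_ge0.
(* [dp] bounds the transport cost, a p-th power, whence the radius dp^(1/p). *)
pose dp := e / (4 * (c + 1)).
have dp0 : 0 < dp by rewrite divr_gt0// mulr_gt0// ltr_wpDl.
exists (dp `^ p^-1); first exact: powR_gt0.
move=> Y FY Hdel; have [pi bpi Hpi] := AW_cost_lt p_ge1 cost0 Hdel.
rewrite -powRrM mulVf ?gt_eqF// powRr1 ?(ltW dp0)// in Hpi.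
have [IS ltS] := intg_Sp Hpi.
pose J w : R := \sum_(1 <= t < N.+1) \1_((z t).2) w.
have I1 t : intg (fs_prob X) (\1_((z t).2) : X -> R).
  by apply: integrable_indic; have [] := zP t.
have [IJ EJ] := Rintegral_big (index_iota 1 N.+1) I1.
have J_le : \int[fs_prob X]_w J w <= N%:R * e1.
  rewrite EJ; apply: (@le_trans _ _ (\sum_(1 <= t < N.+1) e1)); last first.
    by rewrite sumr_const_nat subn1 mulr_natl.
  apply: ler_sum => t _; have [_ mz Pz _] := zP t.
  rewrite /Rintegral integral_indic// setIT -lee_fin fineK//.
  exact: fin_num_measure.
have J0 w : 0 <= J w by rewrite sumr_ge0.
(* One term per case: a near path off the exceptional sets, a path in one of them (where J is at
   least 1), a path moved far. *)
pose D w := e0 + (2 * B * J w.1 + c * @Sp X Y w).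
have IJ2 : intg pi (fun w => 2 * B * J w.1).
  by apply: intgZ; exact: (intg_image measurable_fst (coupling_fst bpi) IJ).
have ID2 : intg pi (fun w => 2 * B * J w.1 + c * Sp w).
  by apply: intgD => //; exact: intgZ.
have Ie0 : intg pi (fun=> e0) by exact: finite_measure_integrable_cst.
apply: (@le_lt_trans _ _ (\int[pi]_w D w)%:E).
  apply: (stopping_value_dist N_gt0 cG GB bpi); first exact: intgD.
  move=> t w tN; have [z1 mz _ Hz] := zP t.
  have le2B : `|G t (path_upto t w.1) - G t (path_upto t w.2)| <= 2 * B.
    apply: le_trans (ler_normB _ _) _.
    by rewrite mulr_natl mulr2n lerD// GB.
  have [Ww|Ww] := pselect ((z t).2 w.1).
    apply: le_trans le2B _; apply: (@le_trans _ _ (2 * B * J w.1)).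
      rewrite ler_peMr ?mulr_ge0// /J (big_rem t) ?mem_index_iota//=.
      by rewrite indicE mem_set// lerDl sumr_ge0.
    by rewrite /D addrCA lerDl addr_ge0 ?(ltW e00)// mulr_ge0.
  have [near_|far] := ltP `|path_upto t w.1 - path_upto t w.2| (z t).1.
    by apply: le_trans (Hz tN _ _ Ww near_) _; rewrite lerDl addr_ge0 ?mulr_ge0.
  have [i Hi] := row_norm_le_exists z1 far.
  apply: le_trans le2B _; apply: (@le_trans _ _ (c * Sp w)); last first.
    by rewrite /D addrA lerDr addr_ge0 ?(ltW e00)// !mulr_ge0.
  apply: (@le_trans _ _ (2 * B * ((z t).1 `^ p)^-1 * Sp w)).
    rewrite -mulrA ler_peMr ?mulr_ge0// mulrC ler_pdivlMr ?powR_gt0// mul1r.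
    apply: le_trans (Sp_ge _ i tN); rewrite ge0_ler_powR ?nnegrE ?(ltW p_gt0) ?(ltW z1)//.
    by move: Hi; rewrite !mxE.
  by rewrite ler_wpM2r// /c (big_rem t) ?mem_index_iota//= lerDl sumr_ge0.
rewrite lte_fin RintegralD// RintegralD//; last exact: intgZ.
rewrite Rintegral_cst_probability.
rewrite (RintegralZl (2 * B) measurableT (intg_image measurable_fst (coupling_fst bpi) IJ)).
rewrite (Rintegral_image measurable_fst (coupling_fst bpi) IJ) RintegralZl//.
have h1 : 2 * B * (N%:R * e1) <= e / 4.
  rewrite (_ : _ * _ = (B / (B + 1)) * (e / 4)); last first.
    by rewrite /e1; field; rewrite !gt_eqF// ltr_wpDl.
  rewrite ler_piMl ?(ltW e00)//.
  by rewrite ler_pdivrMr ?ltr_wpDl// mul1r lerDl.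
have h2 : c * dp <= e / 4.
  rewrite (_ : _ * _ = (c / (c + 1)) * (e / 4)); last first.
    by rewrite /dp; field; rewrite !gt_eqF// ltr_wpDl.
  rewrite ler_piMl ?(ltW e00)//.
  by rewrite ler_pdivrMr ?ltr_wpDl// mul1r lerDl.
have h3 : 2 * B * (\int[fs_prob X]_w J w) <= 2 * B * (N%:R * e1).
  by rewrite ler_wpM2l// mulr_ge0.
have h4 : c * (\int[pi]_w Sp w) <= c * dp by rewrite ler_wpM2l// ltW.
rewrite /e0 /J; lra.
Qed.

End stopping_value_continuity.

Unset Implicit Arguments.

Theorem theorem1p6 (R : realType) (N : nat) (p : R)
    (N_gt0 : (0 < N)%N) (p_ge1 : 1 <= p) :
  ((forall X : filteredProcess R N R, FP p X ->
      exists M A : nat -> X -> R, doob_decomposition M A) /\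
   (exists2 L : R, 0 <= L &
      forall X Y : filteredProcess R N R, FP p X -> FP p Y ->
      forall (M A : nat -> X -> R) (hX : doob_decomposition M A)
             (M' A' : nat -> Y -> R) (hY : doob_decomposition M' A'),
        (AW2 p (doob_process hX) (doob_process hY) <= L%:E * AW p X Y)%E)) /\
  (forall G : forall t : nat, 'rV[R]_t -> R,
    (forall t, (1 <= t <= N)%N -> bounded_fun (G t)) ->
    ((forall t, (1 <= t <= N)%N -> continuous (G t)) ->
       AW_continuous p (stopping_value (N := N) G)) /\
    ((forall t, (1 <= t <= N)%N -> lipschitz (G t)) ->
       AW_lipschitz p (stopping_value (N := N) G))).
Proof.
split; first split.
- by move=> X FX; exact: (doob_decomposition_exists p_ge1).
- exact: doob_lipschitz.
- move=> G bG; have /choice[b bP] : forall t, exists b : R, 0 <= b /\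
      ((1 <= t <= N)%N -> forall x, `|G t x| <= b).
    move=> t; case: (boolP (1 <= t <= N)%N) => [tN|_]; last by exists 0.
    have [M [_ HM]] := bG _ tN; exists (`|M| + 1); split; first by rewrite addr_ge0.
    by move=> _ x; apply: HM => //; rewrite ltr_pwDr// ler_norm.
  have GB t x : (1 <= t <= N)%N -> `|G t x| <= \sum_(1 <= s < N.+1) b s.
    move=> tN; have [_ Gb] := bP t; apply: le_trans (Gb tN x) _.
    rewrite (big_rem t) ?mem_index_iota//= lerDl sumr_ge0// => s _.
    by have [] := bP s.
  split; first exact: (stopping_value_continuous N_gt0 p_ge1 GB).
  exact: (stopping_value_lipschitz N_gt0 p_ge1 GB).
Qed.
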